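(* Let $N\ge 3$, let $a\in\mathbb{R}$ satisfy $N-2+a>0$, and let $\Omega\subset\mathbb{R}^N$ be an open bounded domain containing the origin, star-shaped with respect to the origin, with smooth boundary $\partial\Omega$. Put $\Omega_0=\Omega\setminus\{0\}$ and let $f:\Omega_0\times[0,\infty)\to\mathbb{R}$ be an admissible nonlinearity (as defined in the context). Assume further that for every $(x,y)\in\Omega_0\times[0,\infty)$ the map $$\mu\longmapsto \mu^{-\frac{N+2-a}{N-2+a}}\,f\big(\mu^{-\frac{2}{N-2+a}}x,\ \mu y\big)\quad\text{is non-decreasing on } [1,\infty).$$ Then the boundary-value problem $$\operatorname{div}(|x|^{a}Du)+f(x,u)=0 \ \text{ in }\Omega,\qquad u=0\ \text{ on }\partial\Omega,$$ has no positive solution in $\Omega$.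
   Context: $Du$ denotes the gradient of $u$. A function $f:\Omega_0\times[0,\infty)\to\mathbb{R}$ is called admissible if it is smooth and: (I) $f(x,0)=0$ and $f(x,u)>0$ for all $x\in\Omega_0$, $u>0$; (II) $0\le u\le v$ implies $f(x,u)\le f(x,v)$ for all $x\in\Omega_0$; (III) there is $b_0>a-2>-N$ such that for each compact $\omega\subset[0,\infty)$ there exists $L>0$ with $|f(x,u)-f(x,v)|\le L|x|^{b_0}|u-v|$ for all $x\in\Omega_0$ and $u,v\in\omega$. A positive solution of the problem is a function $u:\Omega\to(0,\infty)$ of class $C^2(\Omega_0)\cap C(\overline{\Omega})$ satisfying the equation pointwise everywhere in $\Omega_0$ and vanishing on $\partial\Omega$. *)

(* Defs.v *)
From HB Require Import structures.
From mathcomp Require Import all_boot all_order all_algebra.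
From mathcomp Require Import all_classical all_reals all_analysis.

Set Implicit Arguments.
Unset Strict Implicit.
Unset Printing Implicit Defensive.

Import Order.TTheory GRing.Theory Num.Theory.
Import numFieldNormedType.Exports.

Local Open Scope classical_set_scope.
Local Open Scope ring_scope.

(* The library norm `|x| on 'rV[R]_N is the sup norm. It induces the usual
   topology and the usual bounded sets, but the length |x| in the equation is
   the Euclidean one. *)
Definition enorm {R : realType} {N : nat} (x : 'rV[R]_N) : R :=
  Num.sqrt (\sum_(i < N) x 0 i ^+ 2).

Definition grad {R : realType} {N : nat} (u : 'rV[R]_N -> R) (x : 'rV[R]_N) :
    'rV[R]_N :=
  \row_(i < N) 'D_(delta_mx 0 i) u x.

Definition diverg {R : realType} {N : nat} (F : 'rV[R]_N -> 'rV[R]_N)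
    (x : 'rV[R]_N) : R :=
  \sum_(i < N) 'D_(delta_mx 0 i) (fun y => F y 0 i) x.

(* Meant for open A and finite-dimensional V, where the continuity of all
   directional derivatives is the continuity of the differential. *)
Fixpoint Ck {R : realType} {V : normedModType R} (k : nat) (A : set V)
    (g : V -> R) : Prop :=
  match k with
  | 0%N => forall x, A x -> {for x, continuous g}
  | k'.+1 => (forall x, A x -> differentiable g x) /\
             (forall v : V, Ck k' A (fun x => 'D_v g x))
  end.

(* Smoothness on a set S that need not be open: near each point of S, g is the
   restriction of a C^oo function defined on an open set. *)
Definition smooth_on {R : realType} {V : normedModType R} (S : set V)
    (g : V -> R) : Prop :=
  forall p, S p -> exists U : set V, exists h : V -> R,
    [/\ open_nbhs p U, (forall k, Ck k U h) & {in U `&` S, g =1 h}].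

Definition boundary {T : topologicalType} (A : set T) : set T :=
  closure A `\` interior A.

(* Near each of its boundary points, Omega is the sublevel set {phi < 0} of a
   C^oo function phi with nonvanishing gradient. *)
Definition smooth_boundary {R : realType} {N : nat} (Omega : set 'rV[R]_N) :
    Prop :=
  forall p, boundary Omega p ->
    exists U : set 'rV[R]_N, exists phi : 'rV[R]_N -> R,
      [/\ open_nbhs p U, (forall k, Ck k U phi),
          (forall x, U x -> grad phi x != 0) &
          (forall x, U x -> (Omega x <-> phi x < 0))].

Definition star_shaped0 {R : realType} {N : nat} (Omega : set 'rV[R]_N) :
    Prop :=
  forall x (t : R), Omega x -> 0 <= t <= 1 -> Omega (t *: x).

Definition punctured {R : realType} {N : nat} (Omega : set 'rV[R]_N) :
    set 'rV[R]_N :=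
  Omega `\ 0.

(* f is a total function, but only its values on Omega_0 x [0, oo) matter. *)
Record admissible {R : realType} {N : nat} (a : R) (Omega : set 'rV[R]_N)
    (f : 'rV[R]_N -> R -> R) : Prop := Admissible {
  adm_smooth :
    smooth_on [set z : 'rV[R]_N * R | punctured Omega z.1 /\ 0 <= z.2]
              (fun z => f z.1 z.2) ;
  adm_zero : forall x, punctured Omega x -> f x 0 = 0 ;
  adm_pos : forall x (u : R), punctured Omega x -> 0 < u -> 0 < f x u ;
  adm_mono : forall x (u v : R),
    punctured Omega x -> 0 <= u -> u <= v -> f x u <= f x v ;
  adm_lipschitz : exists b0 : R,
    [/\ a - 2 < b0, - N%:R < a - 2 &
      forall omega : set R, compact omega -> omega `<=` [set t | 0 <= t] ->
        exists L : R, 0 < L /\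
          forall x u v, punctured Omega x -> omega u -> omega v ->
            `|f x u - f x v| <= L * enorm x `^ b0 * `|u - v| ]
}.

(* u is a total function, but only its values on the closure of Omega matter. *)
Record positive_solution {R : realType} {N : nat} (a : R)
    (Omega : set 'rV[R]_N) (f : 'rV[R]_N -> R -> R) (u : 'rV[R]_N -> R) :
    Prop := PositiveSolution {
  sol_pos : forall x, Omega x -> 0 < u x ;
  sol_C2 : Ck 2 (punctured Omega) u ;
  sol_C0 : {within closure Omega, continuous u} ;
  sol_eq : forall x, punctured Omega x ->
    diverg (fun y => enorm y `^ a *: grad u y) x + f x (u x) = 0 ;
  sol_bdry : forall x : 'rV[R]_N, boundary Omega x -> u x = 0
}.

(* Main.v *)
Require Import Defs.
From HB Require Import structures.
From mathcomp Require Import all_boot all_order all_algebra.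
From mathcomp Require Import all_classical all_reals all_analysis.
From mathcomp Require Import ring lra.

Set Implicit Arguments.
Unset Strict Implicit.
Unset Printing Implicit Defensive.

Import Order.TTheory GRing.Theory Num.Theory.
Import numFieldNormedType.Exports.
Local Open Scope classical_set_scope.
Local Open Scope ring_scope.

(** Moving spheres.  Put k = n - 2 + a > 0, extend the solution u by zero to a
    continuous function U, and for l > 0 let
      v_l(x) = (l / |x|)^k U(l^2 x / |x|^2)
    be its Kelvin transform in the sphere of radius l.  Since Omega is
    star-shaped, l^2 x / |x|^2 belongs to Omega whenever x does and |x| > l, so
    the gap w_l = v_l - U can be studied on D_l = {x in Omega, |x| > l}.  If
    w_l >= 0 on D_l for every l > 0, then
      U(x) <= (l / |x|)^k max U  for all l < |x|,
    and l -> 0 gives U(x) <= 0 for every x <> 0, which is absurd.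

    The operator is handled through flows: |x|^(2-a) div(|x|^a D) equals
    E^2 + k E + sum_(i<j) S_ij^2, where E generates the dilations and S_ij the
    rotation of the (i, j)-plane ([flowLQ_C2], [diverg_flow]).  An inversion
    reverses dilations and commutes with rotations, so it is clear on this form
    that the operator is compatible with the Kelvin transform ([flowL_kelvin]).
    With mu = (|x| / l)^k the monotonicity assumption on f says exactly that v_l
    is a supersolution of the equation in D_l ([flowL_gap]).  Two consequences
    are used.  Where w_l >= 0 the operator maps w_l to a nonpositive value,
    because f is nondecreasing in u ([gap_flow_le0]).  Where m phi touches -w_l
    from above, with phi > 0, the operator maps phi to at least - C phi, where C
    comes from the Lipschitz bound on f and does not depend on l
    ([gap_touch]).

    The inequality w_l >= 0 holds for large l, D_l being empty.  Let L be the
    infimum of the radii above which it holds, and suppose L > 0.  By continuity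
    w_L >= 0, and the strong maximum principle gives w_L > 0 on D_L
    ([gap_gt0]): positivity spreads from the point where a ray leaves Omega,
    where U vanishes but v_L does not.  It remains to exclude, for l close to L,
    a negative minimum x of w_l near each point p of the closure of Omega; then
    w_l >= 0 for l slightly less than L by compactness, against the choice of L.
    If |p| < L, no x near p is in D_l.  If p is in D_L, then w_l > 0 near p.
    If |p| = L or p lies on the boundary of Omega, x lies in a thin layer along a
    smooth hypersurface on which w_l >= 0, and there a barrier phi exists that is
    close to 1 at x, at least 5/4 on the other faces of the layer, and mapped
    by the operator below - C phi ([no_negmin_sphere],
    [no_negmin_boundary]).  Since -w_l never exceeds its value at x, the smallest
    multiple of phi above -w_l must touch it inside the layer, which
    [gap_touch] forbids ([barrier]).

    Corners where the sphere meets the boundary of Omega need no separate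
    treatment: the layer along the sphere is used in full, whatever Omega is
    there.  Neither do the boundary points where the boundary is tangent to the
    rays, at which w_l may vanish. *)

(** * Second-order jets of real functions *)

Section Jets.
Context {R : realType}.
Implicit Types g h : R -> R.

Lemma is_derive_mul (V : normedModType R) (g h : V -> R) (x v : V) (d e : R) :
  is_derive x v g d -> is_derive x v h e ->
  is_derive x v (fun y => g y * h y) (d * h x + g x * e).
Proof.
move=> dg dh; apply: (is_derive_eq (is_deriveM dg dh)).
by rewrite addrC; congr (_ + _); rewrite [LHS]mulrC.
Qed.

(** g'(0) = d1 and g''(0) = d2, as a relation: a function of n variables can
    then be differentiated twice along a curve without first being shown to be
    of class C2. *)
Definition jet2 g (d1 d2 : R) : Prop :=
  exists g1 : R -> R, [/\ \forall t \near (0 : R), is_derive t (1 : R) g (g1 t),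
    g1 0 = d1 & is_derive (0 : R) (1 : R) g1 d2].

Lemma jet2_near_eq g h d1 d2 :
  (\forall t \near (0 : R), g t = h t) -> jet2 g d1 d2 -> jet2 h d1 d2.
Proof.
move=> gh [g1 [dg g10 dg1]]; exists g1; split => //.
have := nbhs_interior gh => gh'.
by near=> t; apply: (@near_eq_is_derive _ _ _ g); near: t.
Unshelve. all: by end_near. Qed.

Lemma jet2_at0 g d1 d2 : jet2 g d1 d2 -> is_derive (0 : R) (1 : R) g d1.
Proof. by move=> [g1 [/nbhs_singleton dg <- _]]. Qed.

Lemma jet2_cst c : jet2 (cst c) 0 0.
Proof.
by exists (cst 0); split => //; [near=> t|]; exact: is_derive_cst.
Unshelve. all: by end_near. Qed.

Lemma jet2D g h d1 d2 e1 e2 : jet2 g d1 d2 -> jet2 h e1 e2 ->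
  jet2 (fun t => g t + h t) (d1 + e1) (d2 + e2).
Proof.
move=> [g1 [dg g10 dg1]] [h1 [dh h10 dh1]].
exists (fun t => g1 t + h1 t); split; last exact: is_deriveD.
- by near=> t; apply: is_deriveD; near: t.
- by rewrite g10 h10.
Unshelve. all: by end_near. Qed.

Lemma jet2M g h d1 d2 e1 e2 : jet2 g d1 d2 -> jet2 h e1 e2 ->
  jet2 (fun t => g t * h t) (d1 * h 0 + g 0 * e1)
    (d2 * h 0 + 2 * d1 * e1 + g 0 * e2).
Proof.
move=> jg jh; have dg0 := jet2_at0 jg; have dh0 := jet2_at0 jh.
move: jg jh => [g1 [dg g10 dg1]] [h1 [dh h10 dh1]].
exists (fun t => g1 t * h t + g t * h1 t); split.
- near=> t; have dgt : is_derive t (1 : R) g (g1 t) by near: t.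
  have dht : is_derive t (1 : R) h (h1 t) by near: t.
  exact: is_derive_mul.
- by rewrite g10 h10.
- apply: (is_derive_eq (is_deriveD (is_derive_mul dg1 dh0) (is_derive_mul dg0 dh1))).
  by rewrite g10 h10; ring.
Unshelve. all: by end_near. Qed.

Lemma jet2Z c g d1 d2 :
  jet2 g d1 d2 -> jet2 (fun t => c * g t) (c * d1) (c * d2).
Proof. by move=> /(jet2M (jet2_cst c)); rewrite /= !(mul0r, add0r, mulr0). Qed.

Lemma jet2_comp (G G1 : R -> R) G2 g d1 d2 :
  (\forall s \near g 0, is_derive s (1 : R) G (G1 s)) ->
  is_derive (g 0) (1 : R) G1 G2 -> jet2 g d1 d2 ->
  jet2 (fun t => G (g t)) (G1 (g 0) * d1) (G2 * d1 ^+ 2 + G1 (g 0) * d2).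
Proof.
move=> dG dG1 jg; have dg0 := jet2_at0 jg.
have cg : g @ 0 --> g 0.
  by apply: differentiable_continuous; apply/derivable1_diffP; case: dg0.
move: jg => [g1 [dg g10 dg1]].
exists (fun t => G1 (g t) * g1 t); split.
- near=> t; have dgt : is_derive t (1 : R) g (g1 t) by near: t.
  have dGt : is_derive (g t) (1 : R) G (G1 (g t)).
    by near: t; exact: (cg _ dG).
  exact: is_derive1_comp.
- by rewrite g10.
- have dc : is_derive (0 : R) (1 : R) (G1 \o g) (G2 * d1) by exact: is_derive1_comp.
  apply: (is_derive_eq (is_derive_mul dc dg1)).
  by rewrite /= g10; ring.
Unshelve. all: by end_near. Qed.

Lemma jet2_opp g d1 d2 : jet2 g d1 d2 -> jet2 (fun t => g (- t)) (- d1) d2.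
Proof.
have dN (s : R) : is_derive s (1 : R) (-%R : R -> R) (-1) by apply: is_derive_eq.
have cN : (-%R : R -> R) @ 0 --> (0 : R).
  by rewrite -{2}oppr0; apply: continuousN; apply: cvg_id.
move=> [g1 [dg g10 dg1]]; exists (fun t => - g1 (- t)); split.
- near=> t.
  have dgt : is_derive (- t) (1 : R) g (g1 (- t)).
    by near: t; exact: (cN _ dg).
  by apply: (is_derive_eq (is_derive1_comp dgt (dN t))); ring.
- by rewrite oppr0 g10.
- have dg10 : is_derive (- 0 : R) (1 : R) g1 d2 by rewrite oppr0.
  by apply: (is_derive_eq (is_deriveN (is_derive1_comp dg10 (dN 0)))); ring.
Unshelve. all: by end_near. Qed.

(** If d2 < 0, then g' < 0 just to the right of 0, where g would decrease by the
    mean value theorem. *)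
Lemma jet2_locmin g d1 d2 : jet2 g d1 d2 ->
  (\forall t \near (0 : R), g 0 <= g t) -> d1 = 0 /\ 0 <= d2.
Proof.
move=> jg gmin; have dg0 := jet2_at0 jg.
move: jg => [g1 [dg g10 dg1]].
have /nbhs_ballP [e /= e0 he] :
  \forall t \near (0 : R), is_derive t (1 : R) g (g1 t) /\ g 0 <= g t.
  by near=> t; split; near: t.
have bal t : `|t| < e -> is_derive t (1 : R) g (g1 t) /\ g 0 <= g t.
  by move=> te; apply: he; rewrite /ball /= sub0r normrN.
have d10 : d1 = 0.
  have [] : is_derive (0 : R) (1 : R) g 0.
    apply: (@derive1_at_min _ g (- e) e 0).
    - lra.
    - move=> t; rewrite in_itv /= => te.
      by have [[]] : is_derive t (1 : R) g (g1 t) /\ g 0 <= g t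
        by apply: bal; rewrite ltr_norml.
    - by rewrite in_itv /=; lra.
    - move=> t; rewrite in_itv /= => te.
      by have [] : is_derive t (1 : R) g (g1 t) /\ g 0 <= g t
        by apply: bal; rewrite ltr_norml.
  by move=> _ g'0; case: dg0 => _; rewrite g'0.
split => //; rewrite leNgt; apply/negP => d20.
(* h is the slope of g', so that g' c = h c * c has the sign of d2. *)
have /is_derive1_caratheodory [h [hE hc h0]] := dg1.
have hneg : \forall t \near (0 : R), h t < 0.
  by apply: (hc [set y | y < 0]); apply: lt_nbhsl; rewrite h0.
have /nbhs_ballP [r /= r0 hr] := hneg.
pose b := Num.min e r / 2.
have b0 : 0 < b by rewrite divr_gt0 // lt_min e0 r0.
have me : Num.min e r <= e by rewrite ge_min lexx.
have mr : Num.min e r <= r by rewrite ge_min lexx orbT.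
have be : b < e by rewrite /b; rewrite /b in b0; lra.
have br : b < r by rewrite /b; rewrite /b in b0; lra.
have [c cb gE] : exists2 c, c \in `]0, b[%R & g b - g 0 = g1 c * (b - 0).
  apply: MVT => //.
    move=> x; rewrite in_itv /= => xb.
    by apply: (bal x _).1; rewrite ltr_norml; lra.
  apply: derivable_within_continuous => x; rewrite in_itv /= => xb.
  by have [[]] : is_derive x (1 : R) g (g1 x) /\ g 0 <= g x
    by apply: bal; rewrite ltr_norml; lra.
move: cb; rewrite in_itv /= => cb.
have hc0 : h c < 0.
  by apply: hr; rewrite /ball /= sub0r normrN ltr_norml; lra.
have gb : g 0 <= g b by apply: (bal b _).2; rewrite ltr_norml; lra.
have g1c : g1 c = h c * c by have := hE c; rewrite g10 d10 !subr0.
have : g1 c * b < 0 by rewrite pmulr_llt0 // g1c pmulr_llt0 //; lra.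
by move: gE; rewrite subr0; lra.
Unshelve. all: by end_near. Qed.

End Jets.

(** * Functions along curves *)

Section Curves.
Context {R : realType} {n : nat}.
Local Notation V := 'rV[R]_n.
Implicit Types (x y z : V) (u : V -> R) (A : set V).

Lemma derive_lin2 u x a b y z : differentiable u x ->
  'D_(a *: y + b *: z) u x = a * 'D_y u x + b * 'D_z u x.
Proof. by move=> du; rewrite !deriveE // linearD !linearZ. Qed.

Lemma derive_coord u x y : differentiable u x ->
  'D_y u x = \sum_(i < n) y 0 i * 'D_(delta_mx 0 i) u x.
Proof.
move=> du; rewrite {1}(row_sum_delta y) deriveE // linear_sum.
by apply: eq_bigr => i _; rewrite linearZ deriveE.
Qed.

Lemma is_derive_curve u (c : R -> V) t v : differentiable u (c t) ->
  is_derive t (1 : R) c v -> is_derive t (1 : R) (fun s => u (c s)) ('D_v u (c t)).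
Proof.
move=> du [dc cv]; have dc' := (derivable1_diffP c t).1 dc.
have duc : differentiable (u \o c) t by exact: differentiable_comp.
apply: DeriveDef; first exact: diff_derivable.
rewrite (deriveE _ duc) diff_comp //= -cv deriveE //.
by rewrite [in RHS]deriveE.
Qed.

(** Dilation orbits and rotation orbits both have this form; y is the velocity
    at 0, and y and z span the acceleration there. *)
Definition bent x y z (al be : R -> R) (t : R) : V := x + al t *: y + be t *: z.

Lemma is_derive_bent x y z al be t a1 b1 :
  is_derive t (1 : R) al a1 -> is_derive t (1 : R) be b1 ->
  is_derive t (1 : R) (bent x y z al be) (a1 *: y + b1 *: z).
Proof.
have dl (f : R -> R) (f1 : R) (w : V) : is_derive t (1 : R) f f1 ->
    is_derive t (1 : R) (fun s => f s *: w) (f1 *: w).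
  move=> [df ff]; have df' := (derivable1_diffP f t).1 df.
  have dfw : differentiable (fun s => f s *: w) t by exact: differentiableZl.
  apply: DeriveDef; first exact: diff_derivable.
  by rewrite (deriveE _ dfw) diffZl //= -ff deriveE.
move=> da db.
have := is_deriveD (is_deriveD (is_derive_cst x t 1) (dl al a1 y da)) (dl be b1 z db).
by rewrite add0r.
Qed.

Lemma cvg_bent x y z al be a1 b1 : al 0 = 0 -> be 0 = 0 ->
  is_derive (0 : R) (1 : R) al a1 -> is_derive (0 : R) (1 : R) be b1 ->
  bent x y z al be @ 0 --> x.
Proof.
move=> al0 be0 da db.
have c0 : bent x y z al be 0 = x by rewrite /bent al0 be0 !scale0r !addr0.
rewrite -[X in _ --> X]c0.
apply: differentiable_continuous; apply/derivable1_diffP.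
by have [] := is_derive_bent x y z da db.
Qed.

(** Chain rule, twice.  As the derivative of be vanishes at 0, the direction z
    enters only through the acceleration of the curve. *)
Lemma jet2_bent u A x y z (al be al1 be1 : R -> R) a2 b2 :
  open A -> A x -> Ck 2 A u ->
  (forall t, is_derive t (1 : R) al (al1 t)) ->
  (forall t, is_derive t (1 : R) be (be1 t)) ->
  is_derive (0 : R) (1 : R) al1 a2 -> is_derive (0 : R) (1 : R) be1 b2 ->
  al 0 = 0 -> be 0 = 0 -> al1 0 = 1 -> be1 0 = 0 ->
  jet2 (fun t => u (bent x y z al be t)) ('D_y u x)
    (a2 * 'D_y u x + b2 * 'D_z u x + 'D_y (fun x' => 'D_y u x') x).
Proof.
move=> oA Ax [du d2u] dal dbe dal1 dbe1 al0 be0 al10 be10.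
pose c := bent x y z al be.
have c0 : c 0 = x by rewrite /c /bent al0 be0 !scale0r !addr0.
have cc := cvg_bent (x := x) y z al0 be0 (dal 0) (dbe 0); rewrite -/c in cc.
have dc t := is_derive_bent x y z (dal t) (dbe t).
exists (fun t => al1 t * 'D_y u (c t) + be1 t * 'D_z u (c t)); split.
- have nA : \forall t \near (0 : R), A (c t) by exact: (cc _ (open_nbhs_nbhs (conj oA Ax))).
  near=> t; have Act : A (c t) by near: t.
  rewrite -derive_lin2; last exact: du.
  by apply: is_derive_curve => //; exact: du.
- by rewrite al10 be10 c0 mul1r mul0r addr0.
- have dd v : is_derive (0 : R) (1 : R) (fun t => 'D_v u (c t)) ('D_y (fun x' => 'D_v u x') x).
    have dv : differentiable (fun x' => 'D_v u x') (c 0) by rewrite c0; exact: (d2u v).1.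
    have := is_derive_curve dv (dc 0).
    by rewrite al10 be10 scale1r scale0r addr0 -/c c0.
  apply: (is_derive_eq (is_deriveD (is_derive_mul dal1 (dd y)) (is_derive_mul dbe1 (dd z)))).
  rewrite al10 be10 c0.
  rewrite !mul1r !mul0r addr0.
  by rewrite addrAC.
Unshelve. all: by end_near. Qed.

End Curves.

(** * Two identities between double sums *)

Section SumIdentities.
Context {R : realType} {n : nat}.
Implicit Types (X D : 'I_n -> R) (H : 'I_n -> 'I_n -> R).

Lemma lagrange_identity X D :
  (\sum_i X i * D i) ^+ 2 + 2^-1 * \sum_i \sum_j (X i * D j - X j * D i) ^+ 2 =
  (\sum_i X i * X i) * \sum_i D i ^+ 2.
Proof.
have e : \sum_i \sum_j (X i * D j - X j * D i) ^+ 2 =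
    (\sum_i X i * X i) * (\sum_i D i ^+ 2) + (\sum_i D i ^+ 2) * (\sum_i X i * X i)
    - 2 * ((\sum_i X i * D i) * (\sum_i X i * D i)).
  rewrite !big_distrlr /= mulr_sumr -sumrN -!big_split /=.
  apply: eq_bigr => i _; rewrite mulr_sumr -sumrN -!big_split /=.
  by apply: eq_bigr => j _; ring.
rewrite e; move: (\sum_i X i * D i) (\sum_i X i * X i) (\sum_i D i ^+ 2) => a b c.
lra.
Qed.

(** With X the position, D the gradient and H the Hessian, the summand is the
    second derivative along the rotation of the (i, j)-plane.  H i j and
    H j i are kept apart: they are partial derivatives taken in different orders. *)
Lemma rotation_sum X D H :
  \sum_i \sum_j (X i ^+ 2 * H j j + X j ^+ 2 * H i i - X i * X j * (H i j + H j i)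
    - (X i * D i + X j * D j) * (i != j)%:R) =
  2 * ((\sum_i X i * X i) * (\sum_i H i i) - \sum_i X i * (\sum_j X j * H i j)
    - (n%:R - 1) * \sum_i X i * D i).
Proof.
have e1 : \sum_i \sum_j X i ^+ 2 * H j j = (\sum_i X i * X i) * \sum_i H i i.
  by rewrite big_distrlr /=; do 2!apply: eq_bigr => ? _; rewrite expr2.
have e2 : \sum_i \sum_j X j ^+ 2 * H i i = (\sum_i X i * X i) * \sum_i H i i.
  by rewrite exchange_big.
have e3 : \sum_i \sum_j X i * X j * H i j = \sum_i X i * (\sum_j X j * H i j).
  by apply: eq_bigr => i _; rewrite mulr_sumr; apply: eq_bigr => j _; rewrite mulrA.
have e4 : \sum_i \sum_j X i * X j * H j i = \sum_i X i * (\sum_j X j * H i j).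
  rewrite exchange_big /= -e3.
  by do 2!apply: eq_bigr => ? _; rewrite (mulrC (X _) (X _)).
have e5 : \sum_i \sum_j (X i * D i + X j * D j) * (i != j)%:R =
    2 * ((n%:R - 1) * \sum_i X i * D i).
  have e6 i : \sum_j (X i * D i + X j * D j) * (i != j)%:R =
      X i * D i *+ n + \sum_j X j * D j - 2 * (X i * D i).
    have -> : X i * D i *+ n = \sum_(j < n) X i * D i by rewrite sumr_const card_ord.
    rewrite -big_split /= (bigD1 i) //= [in RHS](bigD1 i) //= eqxx mulr0 add0r.
    have -> : \sum_(j < n | j != i) (X i * D i + X j * D j) * (i != j)%:R =
        \sum_(j < n | j != i) (X i * D i + X j * D j).
      by apply: eq_bigr => j; rewrite eq_sym => ->; rewrite mulr1.
    by rewrite [RHS]addrC mulr_natl mulr2n addKr.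
  under eq_bigr do rewrite e6.
  rewrite sumrB big_split /= sumr_const card_ord -mulr_sumr sumrMnl.
  by move: (\sum_i X i * D i) => s; rewrite -(mulr_natl s n); ring.
under eq_bigr => i _.
  under eq_bigr do rewrite mulrDr.
  rewrite !sumrB !big_split /=; over.
rewrite /= !sumrB !big_split /= e1 e2 e3 e4 e5.
move: (\sum_i X i * X i) (\sum_i H i i) (\sum_i X i * D i).
move: (\sum_i X i * (\sum_j X j * H i j)) => d a b c.
by ring.
Qed.

End SumIdentities.

(** * The weighted operator as a sum of squares of flows *)

Section Flow.
Context {R : realType} {n : nat}.
Local Notation V := 'rV[R]_n.
Implicit Types (x y z : V) (F G u : V -> R) (A : set V) (k : R).

Definition dot x y : R := \sum_(i < n) x 0 i * y 0 i.

Definition dil x (t : R) : V := expR t *: x.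

Definition spinv x i j : V := x 0 i *: delta_mx 0 j + (- x 0 j) *: delta_mx 0 i.

(** Minus the acceleration of the rotation.  The factor [i != j] makes the
    degenerate rotations constant, so that sums may run over all pairs. *)
Definition spinz x i j : V :=
  (x 0 i * (i != j)%:R) *: delta_mx 0 i + (x 0 j * (i != j)%:R) *: delta_mx 0 j.

Definition spin i j x (t : R) : V := x + sin t *: spinv x i j + (cos t - 1) *: spinz x i j.

(** M is the value at x of (E^2 + k E + sum_(i<j) S_ij^2) F, where E is the
    dilation field and S_ij are the rotation fields; the sum is taken over
    ordered pairs, hence the factor 1/2.  Q is |x|^2 |DF|^2, the quadratic term
    that appears when F is composed with a function of one variable. *)
Definition flowLQ k F x (M Q : R) : Prop :=
  exists e1 e2, exists r1 r2 : 'I_n -> 'I_n -> R,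
  [/\ jet2 (fun t => F (dil x t)) e1 e2,
      forall i j, jet2 (fun t => F (spin i j x t)) (r1 i j) (r2 i j),
      M = e2 + k * e1 + 2^-1 * \sum_i \sum_j r2 i j &
      Q = e1 ^+ 2 + 2^-1 * \sum_i \sum_j r1 i j ^+ 2].

Definition flowL k F x M := exists Q, flowLQ k F x M Q.

Lemma dil0 x : dil x 0 = x. Proof. by rewrite /dil expR0 scale1r. Qed.

Lemma spin0 i j x : spin i j x 0 = x.
Proof. by rewrite /spin sin0 cos0 subrr !scale0r !addr0. Qed.

Lemma dilE x t : dil x t = bent x x 0 (fun t => expR t - 1) (fun t => 0) t.
Proof. by rewrite /bent scaler0 addr0 scalerBl scale1r addrC subrK. Qed.

Let d_exp1 (t : R) : is_derive t (1 : R) (fun t : R => expR t - 1) (expR t).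
Proof.
apply: (is_derive_eq (is_deriveB (is_derive_expR t) (is_derive_cst (1 : R) t 1))).
by rewrite subr0.
Qed.

Let d_cos1 (t : R) : is_derive t (1 : R) (fun t : R => cos t - 1) (- sin t).
Proof.
apply: (is_derive_eq (is_deriveB (is_derive_cos t) (is_derive_cst (1 : R) t 1))).
by rewrite subr0.
Qed.

Lemma cvg_dil x : dil x @ 0 --> x.
Proof.
rewrite (_ : dil x = bent x x 0 (fun t => expR t - 1) (fun t => 0)); last first.
  by apply/funext => t; exact: dilE.
apply: (@cvg_bent R n x x 0 _ _ (expR 0) 0) => //.
by rewrite expR0 subrr.
Qed.

Lemma cvg_spin i j x : spin i j x @ 0 --> x.
Proof.
apply: (@cvg_bent R n x _ _ sin (fun t => cos t - 1) (cos 0) (- sin 0)) => //.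
- exact: sin0.
- by rewrite cos0 subrr.
Qed.

Lemma flowLQ_near k F G x M Q : (\forall y \near x, F y = G y) ->
  flowLQ k F x M Q -> flowLQ k G x M Q.
Proof.
move=> FG [e1 [e2 [r1 [r2 [je jr ME QE]]]]]; exists e1, e2, r1, r2; split => //.
- apply: jet2_near_eq je; exact: (@cvg_dil x _ FG).
- move=> i j; apply: jet2_near_eq (jr i j); exact: (@cvg_spin i j x _ FG).
Qed.

Lemma flowLD k F G x M P : flowL k F x M -> flowL k G x P ->
  flowL k (fun y => F y + G y) x (M + P).
Proof.
move=> [Q [e1 [e2 [r1 [r2 [je jr -> _]]]]]] [Q' [f1 [f2 [s1 [s2 [jf js -> _]]]]]].
eexists; exists (e1 + f1), (e2 + f2), (fun i j => r1 i j + s1 i j).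
exists (fun i j => r2 i j + s2 i j); split; last by [].
- exact: (jet2D je jf).
- by move=> i j; exact: (jet2D (jr i j) (js i j)).
- under [X in _ = _ + _ * X]eq_bigr do rewrite big_split.
  by rewrite big_split /=; lra.
Qed.

Lemma flowLQ_comp k F x M Q (G G1 : R -> R) (G2 : R) : flowLQ k F x M Q ->
  (\forall s \near F x, is_derive s (1 : R) G (G1 s)) ->
  is_derive (F x) (1 : R) G1 G2 ->
  flowLQ k (fun y => G (F y)) x (G2 * Q + G1 (F x) * M) (G1 (F x) ^+ 2 * Q).
Proof.
move=> [e1 [e2 [r1 [r2 [je jr -> ->]]]]] dG dG1.
exists (G1 (F x) * e1), (G2 * e1 ^+ 2 + G1 (F x) * e2).
exists (fun i j => G1 (F x) * r1 i j).
exists (fun i j => G2 * r1 i j ^+ 2 + G1 (F x) * r2 i j); split.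
- have := @jet2_comp R G G1 G2 (fun t => F (dil x t)) e1 e2.
  by rewrite dil0; apply.
- move=> i j; have := @jet2_comp R G G1 G2 (fun t => F (spin i j x t)) (r1 i j) (r2 i j).
  by rewrite spin0; apply.
- under [X in _ = _ + _ * X]eq_bigr do rewrite big_split -!mulr_sumr.
  rewrite big_split /= -!mulr_sumr.
  set a := \sum_i _; set b := \sum_i _; clearbody a b; clear; ring.
- under [X in _ = _ + _ * X]eq_bigr => i _.
    under eq_bigr do rewrite exprMn.
    rewrite -mulr_sumr; over.
  rewrite -mulr_sumr.
  set a := \sum_i _; clearbody a; clear; ring.
Qed.

Lemma flowLZ k c F x M : flowL k F x M -> flowL k (fun y => c * F y) x (c * M).
Proof.
move=> [Q FM]; exists (c ^+ 2 * Q).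
have dc s : is_derive s (1 : R) (fun t : R => c * t) c.
  have := is_derive_mul (is_derive_cst c s (1 : R)) (is_derive_id s (1 : R)).
  by rewrite mul0r add0r mulr1.
have := @flowLQ_comp k F x M Q (fun t => c * t) (fun=> c) 0 FM _ (is_derive_cst c (F x) (1 : R)).
by rewrite mul0r add0r; apply; near=> s; exact: dc.
Unshelve. all: by end_near. Qed.

Lemma flowLB k F G x M P : flowL k F x M -> flowL k G x P ->
  flowL k (fun y => F y - G y) x (M - P).
Proof.
move=> FM /(flowLZ (-1)) /(flowLD FM); rewrite mulN1r.
by congr (flowL _ _ _ _); apply/funext => y; rewrite mulN1r.
Qed.

(** Along each curve a local minimum has zero velocity and nonnegative
    acceleration, and M is a nonnegative combination of the accelerations. *)
Lemma flowL_locmin k F x M : flowL k F x M -> (\forall y \near x, F x <= F y) -> 0 <= M.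
Proof.
move=> [Q [e1 [e2 [r1 [r2 [je jr -> _]]]]]] Fmin.
have [e10 e20] : e1 = 0 /\ 0 <= e2.
  by apply: (jet2_locmin je); rewrite dil0; exact: (@cvg_dil x _ Fmin).
rewrite e10 mulr0 addr0 addr_ge0 // mulr_ge0 ?invr_ge0 //.
apply: sumr_ge0 => i _; apply: sumr_ge0 => j _.
apply: (jet2_locmin (jr i j) _).2.
by rewrite spin0; exact: (@cvg_spin i j x _ Fmin).
Qed.

Definition pd u i x := 'D_(delta_mx 0 i) u x.

Definition flowM k u x : R :=
  dot x x * \sum_i pd (pd u i) i x + (k + 2 - n%:R) * \sum_i x 0 i * pd u i x.

Definition flowQ u x : R := dot x x * \sum_i pd u i x ^+ 2.

(** E^2 produces the Hessian in the direction x, the rotations produce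
    |x|^2 Laplacian minus that Hessian, and the accelerations of the curves
    leave E and -(n - 1) E. *)
Lemma flowLQ_C2 k u A x : open A -> A x -> Ck 2 A u ->
  flowLQ k u x (flowM k u x) (flowQ u x).
Proof.
rewrite /flowM /flowQ => oA Ax C2; have [du d2u] := C2.
(* H i j is the derivative in direction i of the j-th partial derivative. *)
pose D i := pd u i x; pose H i j := pd (pd u j) i x; pose X i := x 0 i.
have dxE y : 'D_y u x = \sum_i y 0 i * D i by rewrite derive_coord //; exact: du.
have ddE y z : 'D_y (fun x' => 'D_z u x') x = \sum_i y 0 i * \sum_j z 0 j * H i j.
  rewrite derive_coord; last exact: (d2u z).1.
  apply: eq_bigr => i _; congr (_ * _).
  have nA : \forall x' \near x, 'D_z u x' = \sum_(j < n) z 0 j * pd u j x'.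
    near=> x'; rewrite derive_coord //; apply: du; near: x'.
    exact: open_nbhs_nbhs.
  rewrite /pd (near_eq_derive _ nA) /=.
  have dpd j : derivable (pd u j) x (delta_mx 0 i) by exact/diff_derivable/(d2u _).1.
  have -> : (fun x' => \sum_(j < n) z 0 j * pd u j x') = \sum_(j < n) (z 0 j *: pd u j).
    by apply/funext => x'; rewrite fct_sumE.
  rewrite derive_sum; last by move=> j; exact: derivableZ.
  by apply: eq_bigr => j _; rewrite deriveZ.
have dy i j : 'D_(spinv x i j) u x = X i * D j - X j * D i.
  by rewrite derive_lin2 ?mulNr //; exact: du.
have dz i j : 'D_(spinz x i j) u x = (X i * D i + X j * D j) * (i != j)%:R.
  rewrite derive_lin2; last exact: du.
  set b := (i != j)%:R; clearbody b.
  change (X i * b * D i + X j * b * D j = (X i * D i + X j * D j) * b).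
  by move: (D i) (D j) (X i) (X j) => ? ? ? ?; ring.
have dyy i j : 'D_(spinv x i j) (fun x' => 'D_(spinv x i j) u x') x =
    X i ^+ 2 * H j j + X j ^+ 2 * H i i - X i * X j * (H i j + H j i).
  have nA : \forall x' \near x, 'D_(spinv x i j) u x' = X i * pd u j x' + (- X j) * pd u i x'.
    near=> x'; rewrite derive_lin2 //; apply: du; near: x'.
    exact: open_nbhs_nbhs.
  rewrite derive_lin2; last exact: (d2u _).1.
  rewrite !(near_eq_derive _ nA).
  have dpd l v : derivable (pd u l) x v by exact/diff_derivable/(d2u _).1.
  rewrite !deriveD; try exact: derivableZ.
  rewrite !deriveZ //.
  change (X i * (X i * H j j + (- X j) * H j i) +
    (- X j) * (X i * H i j + (- X j) * H i i) =
    X i ^+ 2 * H j j + X j ^+ 2 * H i i - X i * X j * (H i j + H j i)).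
  by move: (H j j) (H i i) (H i j) (H j i) (X i) (X j) => ? ? ? ? ? ?; ring.
pose E := \sum_i X i * D i.
pose HH := \sum_i X i * \sum_j X j * H i j.
exists E, (E + HH), (fun i j => X i * D j - X j * D i).
exists (fun i j => X i ^+ 2 * H j j + X j ^+ 2 * H i i - X i * X j * (H i j + H j i)
    - (X i * D i + X j * D j) * (i != j)%:R); split.
- have := @jet2_bent _ _ u A x x 0 (fun t => expR t - 1) (fun=> 0) expR (fun=> 0) 1 0
    oA Ax C2 d_exp1 (fun t => is_derive_cst (0 : R) t 1).
  rewrite dxE -/E ddE -/HH mul0r addr0 mul1r.
  under [X in _ -> jet2 X _ _]eq_fun do rewrite dilE.
  apply => //; last by rewrite expR0.
  + by apply: (is_derive_eq (is_derive_expR 0)); rewrite expR0.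
  + by rewrite expR0 subrr.
- move=> i j.
  have := @jet2_bent _ _ u A x (spinv x i j) (spinz x i j) sin (fun t => cos t - 1) cos
    (fun t => - sin t) 0 (-1) oA Ax C2 (@is_derive_sin R) d_cos1.
  rewrite dy dz dyy mul0r add0r mulN1r [- _ + _]addrC.
  apply => //.
  + by apply: (is_derive_eq (is_derive_cos 0)); rewrite sin0 oppr0.
  + by apply: (is_derive_eq (is_deriveN (is_derive_sin 0))); rewrite cos0.
  + exact: sin0.
  + by rewrite cos0 subrr.
  + exact: cos0.
  + by rewrite sin0 oppr0.
- rewrite rotation_sum -/E -/HH mulrA mulVf ?mul1r ?pnatr_eq0 //.
  rewrite [in LHS]/dot -[in LHS]/(\sum_i X i * X i).
  change (\sum_i x 0 i * pd u i x) with E.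
  change (\sum_i pd (pd u i) i x) with (\sum_i H i i).
  change (\sum_i x 0 i * x 0 i) with (\sum_i X i * X i).
  move: E HH (\sum_i H i i) (\sum_i X i * X i) => a b c d.
  clear; ring.
- by rewrite lagrange_identity.
Unshelve. all: by end_near. Qed.

End Flow.

(** * Euclidean geometry *)

Section Euclid.
Context {R : realType} {n : nat}.
Local Notation V := 'rV[R]_n.
Implicit Types (x y z v w p : V) (u : V -> R) (A : set V).

Lemma dotC x y : dot x y = dot y x.
Proof. by apply: eq_bigr => i _; rewrite mulrC. Qed.

Lemma dotDl x y z : dot (x + y) z = dot x z + dot y z.
Proof. by rewrite -big_split; apply: eq_bigr => i _; rewrite mxE mulrDl. Qed.

Lemma dotZl c x y : dot (c *: x) y = c * dot x y.
Proof. by rewrite mulr_sumr; apply: eq_bigr => i _; rewrite mxE mulrA. Qed.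

Lemma dotDr x y z : dot z (x + y) = dot z x + dot z y.
Proof. by rewrite dotC dotDl !(dotC z). Qed.

Lemma dotZr c x y : dot x (c *: y) = c * dot x y.
Proof. by rewrite dotC dotZl dotC. Qed.

Lemma dot_delta x i : dot x (delta_mx 0 i) = x 0 i.
Proof.
rewrite /dot (bigD1 i) //= mxE !eqxx mulr1 big1 ?addr0 // => j ji.
by rewrite mxE eqxx (negbTE ji) mulr0.
Qed.

Lemma enormE x : enorm x = Num.sqrt (dot x x).
Proof. by congr Num.sqrt; apply: eq_bigr => i _; rewrite expr2. Qed.

Lemma dot_ge0 x : 0 <= dot x x.
Proof. by apply: sumr_ge0 => i _; rewrite -expr2 sqr_ge0. Qed.

Lemma enorm_sqr x : enorm x ^+ 2 = dot x x.
Proof. by rewrite enormE sqr_sqrtr ?dot_ge0. Qed.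

Lemma enorm_ge0 x : 0 <= enorm x. Proof. exact: sqrtr_ge0. Qed.

Lemma dot_eq0 x : (dot x x == 0) = (x == 0).
Proof.
apply/idP/eqP => [|->]; last first.
  by rewrite /dot big1 // => i _; rewrite mxE mul0r.
rewrite psumr_eq0; last by move=> i _; rewrite -expr2 sqr_ge0.
move=> /allP x0; apply/rowP => i; rewrite mxE; apply/eqP.
by have := x0 i; rewrite mem_index_enum mulf_eq0 orbb; apply.
Qed.

Lemma enorm_gt0 x : (0 < enorm x) = (x != 0).
Proof. by rewrite enormE sqrtr_gt0 lt_neqAle dot_ge0 andbT eq_sym dot_eq0. Qed.

Lemma enormZ c x : enorm (c *: x) = `|c| * enorm x.
Proof. by rewrite !enormE dotZl dotZr mulrA -expr2 sqrtrM ?sqr_ge0 // sqrtr_sqr. Qed.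

Lemma enorm_dil x t : enorm (dil x t) = expR t * enorm x.
Proof. by rewrite enormZ gtr0_norm ?expR_gt0. Qed.

Lemma enorm_spin i j x t : enorm (spin i j x t) = enorm x.
Proof.
rewrite !enormE; congr Num.sqrt.
have [->|ij] := eqVneq i j.
  rewrite /spin /spinv /spinz eqxx mulr0 !scale0r addr0 scaler0 addr0 -scalerDl subrr.
  by rewrite scale0r scaler0 addr0.
(* x . y = y . z = 0 and x . z = y . y = z . z = s. *)
set y := spinv x i j; set z := spinz x i j; set s := x 0 i ^+ 2 + x 0 j ^+ 2.
have dd k l : dot (delta_mx 0 k) (delta_mx 0 l : V) = (k == l)%:R.
  by rewrite dot_delta mxE eqxx eq_sym.
have yE : y = x 0 i *: delta_mx 0 j + (- x 0 j) *: delta_mx 0 i by [].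
have zE : z = x 0 i *: delta_mx 0 i + x 0 j *: delta_mx 0 j.
  by rewrite /z /spinz ij !mulr1.
have xy : dot x y = 0 by rewrite yE dotDr !dotZr !dot_delta; ring.
have xz : dot x z = s by rewrite zE dotDr !dotZr !dot_delta /s; ring.
have ji : (j == i) = false by rewrite eq_sym (negbTE ij).
have yy : dot y y = s.
  by rewrite yE !(dotDl, dotDr, dotZl, dotZr) !dd !eqxx ji (negbTE ij) /s /=; ring.
have yz : dot y z = 0.
  by rewrite yE zE !(dotDl, dotDr, dotZl, dotZr) !dd !eqxx ji (negbTE ij) /=; ring.
have zz : dot z z = s.
  by rewrite zE !(dotDl, dotDr, dotZl, dotZr) !dd !eqxx ji (negbTE ij) /s /=; ring.
rewrite /spin -/y -/z; clearbody y z.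
rewrite !(dotDl, dotDr, dotZl, dotZr) (dotC y x) (dotC z x) (dotC z y).
rewrite xy xz yy yz zz; have := cos2Dsin2 t => ct.
transitivity (dot x x + s * (cos t ^+ 2 + sin t ^+ 2 - 1)); first by ring.
by rewrite ct; ring.
Qed.

Lemma spinZ i j c x t : spin i j (c *: x) t = c *: spin i j x t.
Proof.
rewrite /spin /spinv /spinz !mxE; set b := (i != j)%:R; clearbody b.
rewrite !(scalerDr, scalerA); congr (_ + (_ *: _ + _ *: _) + (_ *: _ + _ *: _)); ring.
Qed.

Lemma is_derive_coord x v i : is_derive x v (fun y : V => y 0 i) (v 0 i).
Proof.
apply: DeriveDef; first exact/diff_derivable/differentiable_coord.
have := derive_mx (@derivable_id _ _ x v); rewrite derive_id => /rowP /(_ i).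
by rewrite mxE.
Qed.

Definition sqdist p x := dot (x - p) (x - p).

Lemma differentiable_dot2 (f g : V -> V) x :
  (forall i, differentiable (fun y => f y 0 i) x) ->
  (forall i, differentiable (fun y => g y 0 i) x) ->
  differentiable (fun y => dot (f y) (g y)) x.
Proof.
move=> df dg.
have -> : (fun y => dot (f y) (g y)) = \sum_(i < n) (fun y => f y 0 i * g y 0 i).
  by apply/funext => y; rewrite fct_sumE.
by apply: differentiable_sum => i; exact: differentiableM.
Qed.

Lemma differentiable_subc p x i : differentiable (fun y : V => (y - p) 0 i) x.
Proof.
have -> : (fun y : V => (y - p) 0 i) = (fun y : V => y 0 i) - cst (p 0 i).
  by apply/funext => y; rewrite !mxE.
by apply: differentiableB; [exact: differentiable_coord|exact: differentiable_cst].
Qed.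

Lemma differentiable_sqdist p x : differentiable (sqdist p) x.
Proof. by apply: differentiable_dot2 => i; exact: differentiable_subc. Qed.

Lemma is_derive_dotl p v w x : is_derive x w (fun y => dot (y - p) v) (dot w v).
Proof.
have -> : (fun y => dot (y - p) v) =
    \sum_(i < n) (v 0 i *: ((fun y : V => y 0 i) - cst (p 0 i))).
  by apply/funext => y; rewrite fct_sumE; apply: eq_bigr => i _; rewrite !mxE mulrC.
rewrite dotC; apply: is_derive_sum => i; apply: is_deriveZ.
have := is_deriveB (is_derive_coord x w i) (is_derive_cst (p 0 i) x w).
by rewrite subr0.
Qed.

Lemma is_derive_sqdist p v x : is_derive x v (sqdist p) (2 * dot (x - p) v).
Proof.
pose f i := (fun y : V => y 0 i) - cst (p 0 i).
have df i : is_derive x v (f i) (v 0 i).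
  have := is_deriveB (is_derive_coord x v i) (is_derive_cst (p 0 i) x v).
  by rewrite subr0.
have -> : sqdist p = \sum_(i < n) (fun y => f i y * f i y).
  by apply/funext => y; rewrite fct_sumE; apply: eq_bigr => i _; rewrite !mxE.
apply: (is_derive_eq (is_derive_sum (fun i => is_derive_mul (df i) (df i)))).
rewrite mulr_sumr; apply: eq_bigr => i _.
have -> : f i x = (x - p) 0 i by rewrite !mxE.
by ring.
Qed.

End Euclid.

(** * The equation and the Kelvin transform in terms of flows *)

Section Kelvin.
Context {R : realType} {n : nat}.
Local Notation V := 'rV[R]_n.
Implicit Types (x y z v w p : V) (u : V -> R) (A : set V).

Lemma is_derive_comp1 (F : V -> R) (G : R -> R) x v (d g : R) : differentiable F x ->
  is_derive x v F d -> is_derive (F x) (1 : R) G g ->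
  is_derive x v (fun y => G (F y)) (g * d).
Proof.
move=> dF [_ Fd] [dG Gd]; have dG' := (derivable1_diffP _ _).1 dG.
have dGF : differentiable (G \o F) x by exact: differentiable_comp.
apply: DeriveDef; first exact: diff_derivable.
rewrite (deriveE _ dGF) diff_comp //= -(deriveE _ dF) Fd -Gd (deriveE _ dG').
by rewrite -[d in LHS]mulr1 -[d * 1]/(d *: (1 : R)) linearZ mulrC.
Qed.

Lemma enorm_powR x (a : R) : enorm x `^ a = dot x x `^ (a / 2).
Proof. by rewrite enormE -powR12_sqrt ?dot_ge0 // -powRrM mulrC. Qed.

(** D_i |x|^a = a |x|^(a-2) x_i, so the divergence is
    |x|^a Laplacian u + a |x|^(a-2) x . Du. *)
Lemma diverg_flow u A (a : R) x : open A -> A x -> Ck 2 A u -> x != 0 ->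
  diverg (fun y => enorm y `^ a *: grad u y) x =
  enorm x `^ (a - 2) * flowM (n%:R - 2 + a) u x.
Proof.
have -> : flowM (n%:R - 2 + a) u x =
    dot x x * \sum_i pd (pd u i) i x + a * \sum_i x 0 i * pd u i x.
  by rewrite /flowM; congr (_ + _ * _); ring.
move=> oA Ax [du d2u] x0.
have q0 : sqdist 0 x = dot x x by rewrite /sqdist subr0.
have xx0 : 0 < dot x x by rewrite lt_neqAle dot_ge0 eq_sym dot_eq0 x0.
have epow : enorm x `^ a = enorm x `^ (a - 2) * dot x x.
  rewrite -enorm_sqr -powR_mulrn ?enorm_ge0 // -powRD; first by congr powR; lra.
  by rewrite (gt_eqF (_ : 0 < enorm x)) ?implybT // enorm_gt0.
have dpow i : is_derive x (delta_mx 0 i) (fun y : V => enorm y `^ a)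
    (a * enorm x `^ (a - 2) * x 0 i).
  have -> : (fun y : V => enorm y `^ a) = (fun y => (sqdist 0 y) `^ (a / 2)).
    by apply/funext => y; rewrite enorm_powR /sqdist subr0.
  have dp : is_derive (sqdist 0 x) (1 : R) (fun t : R => t `^ (a / 2))
      (a / 2 * (sqdist 0 x) `^ (a / 2 - 1)).
    by apply: is_derive1_powR; rewrite q0.
  apply: (is_derive_eq (is_derive_comp1 (differentiable_sqdist 0 x) (is_derive_sqdist 0 _ x) dp)).
  rewrite dot_delta subr0 q0 enorm_powR.
  have -> : (a - 2) / 2 = a / 2 - 1 by lra.
  by move: (_ `^ _) (x 0 i) => s t; lra.
rewrite mulrDr !mulr_sumr -big_split /=; apply: eq_bigr => i _.
have -> : (fun y => (enorm y `^ a *: grad u y) 0 i) = (fun y => enorm y `^ a * pd u i y).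
  by apply/funext => y; rewrite !mxE.
have dpd : is_derive x (delta_mx 0 i) (pd u i) (pd (pd u i) i x).
  by apply/derivableP/diff_derivable/(d2u _).1.
have [_ ->] := is_derive_mul (dpow i) dpd.
rewrite epow; move: (enorm x `^ _) (pd _ _ _) (pd _ _ _) (dot x x) (x 0 i) => r s t w z.
by ring.
Qed.

Definition invn (l : R) x : V := (l ^+ 2 / enorm x ^+ 2) *: x.

Definition kelvin (k l : R) u x : R := (l / enorm x) `^ k * u (invn l x).

(** Along a dilation orbit the Kelvin transform is a multiple of
    e^(-k t) g(-t), where g is u along the orbit of the inverted point; the
    operator g'' + k g' takes the same value on both functions at 0.  Rotations
    commute with the inversion. *)
Lemma flowL_kelvin k l u x M : 0 < l -> x != 0 -> flowL k u (invn l x) M ->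
  flowL k (kelvin k l u) x ((l / enorm x) `^ k * M).
Proof.
move=> l0 x0 [Q [e1 [e2 [r1 [r2 [je jr -> _]]]]]].
have r0 : 0 < enorm x by rewrite enorm_gt0.
have rN0 := lt0r_neq0 r0.
set c := (l / enorm x) `^ k.
have kd t : kelvin k l u (dil x t) = c * (expR (- k * t) * u (dil (invn l x) (- t))).
  rewrite /kelvin enorm_dil mulrA; congr (_ * u _).
    have -> : l / (expR t * enorm x) = l / enorm x * expR (- t).
      by rewrite expRN invfM mulrA mulrAC.
    rewrite powRM ?expR_ge0 //; last by rewrite divr_ge0 ?ltW.
    by rewrite -expRM; congr (_ * expR _); ring.
  rewrite /invn enorm_dil /dil !scalerA expRN; congr (_ *: _).
  have := lt0r_neq0 (expR_gt0 t); move: (expR t) => E E0.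
  by field; rewrite rN0 E0.
have ks i j t : kelvin k l u (spin i j x t) = c * u (spin i j (invn l x) t).
  by rewrite /kelvin enorm_spin /invn enorm_spin spinZ.
(* For h t = e^(-k t) g(-t), the terms in g cancel in h'' + k h'. *)
have jexp : jet2 (fun t : R => expR (- k * t)) (- k) (k ^+ 2).
  have dl (s : R) : is_derive s (1 : R) (fun t => - k * t) (- k).
    have := is_derive_mul (is_derive_cst (- k) s (1 : R)) (is_derive_id s (1 : R)).
    by rewrite mul0r add0r mulr1.
  have de (s : R) : is_derive s (1 : R) (fun t => expR (- k * t)) (expR (- k * s) * - k).
    exact: (is_derive1_comp (is_derive_expR (- k * s)) (dl s)).
  exists (fun t => expR (- k * t) * - k); split.
  - by near=> s; exact: de.
  - by rewrite mulr0 expR0 mul1r.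
  - apply: (is_derive_eq (is_derive_mul (de 0) (is_derive_cst (- k) (0 : R) (1 : R)))).
    by rewrite /cst !mulr0 addr0 expR0; ring.
eexists.
exists (c * (- k * u (invn l x) + - e1)), (c * (k ^+ 2 * u (invn l x) + 2 * k * e1 + e2)).
exists (fun i j => c * r1 i j), (fun i j => c * r2 i j); split; last by [].
- under eq_fun do rewrite kd.
  apply: jet2Z; have := jet2M jexp (jet2_opp je).
  rewrite mulr0 oppr0 expR0 !mul1r dil0.
  by rewrite -[2 * - k * - e1]mulrA mulrNN mulrA.
- by move=> i j; under eq_fun do rewrite ks; exact: jet2Z.
- under [X in _ = _ + _ * X]eq_bigr do rewrite -mulr_sumr.
  rewrite -mulr_sumr.
  by move: (\sum_i _) (u _) => s t; ring.
Unshelve. all: by end_near. Qed.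

Lemma enorm_invn l x : 0 < l -> x != 0 -> enorm (invn l x) = l ^+ 2 / enorm x.
Proof.
move=> l0; rewrite -enorm_gt0 => r0; rewrite enormZ ger0_norm ?divr_ge0 ?sqr_ge0 //.
by field; rewrite gt_eqF.
Qed.

Lemma invn_neq0 l x : 0 < l -> x != 0 -> invn l x != 0.
Proof.
by move=> l0 x0; rewrite -enorm_gt0 enorm_invn // divr_gt0 ?exprn_gt0 // enorm_gt0.
Qed.

End Kelvin.

(** * Continuity of the extension by zero and of the Kelvin transform *)

Section Continuity.
Context {R : realType} {n : nat}.
Local Notation V := 'rV[R]_n.
Implicit Types (x y p : V).

Lemma continuous_sqdist p : continuous (sqdist p : V -> R).
Proof. by move=> x; apply: differentiable_continuous; exact: differentiable_sqdist. Qed.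

Lemma continuous_enorm : continuous (@enorm R n).
Proof.
move=> x; have -> : @enorm R n = Num.sqrt \o sqdist 0.
  by apply/funext => y; rewrite enormE /= /sqdist subr0.
by apply: continuous_comp; [exact: continuous_sqdist|exact: sqrt_continuous].
Qed.

Lemma continuous_powR (k t : R) : 0 < t -> {for t, continuous (fun s : R => s `^ k)}.
Proof.
move=> t0; apply: differentiable_continuous; apply/derivable1_diffP.
by have [] := is_derive1_powR k t0.
Qed.

Definition ext (Omega : set V) (u : V -> R) x : R := if `[< Omega x >] then u x else 0.

Lemma continuous_ext Omega u : open Omega -> {within closure Omega, continuous u} ->
  (forall x, boundary Omega x -> u x = 0) -> continuous (ext Omega u).
Proof.
move=> oO cu ub x.
have [clx|nclx] := pselect (closure Omega x); last first.
  have nO y : ~ closure Omega y -> ext Omega u y = 0.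
    by move=> ny; rewrite /ext; case: asboolP => // /subset_closure.
  suff h : \forall y \near x, ext Omega u y = ext Omega u x by exact: cvg_near_cst h.
  have oC : open (~` closure Omega) by rewrite openC; exact: closed_closure.
  have nC : \forall y \near x, ~ closure Omega y by exact: open_nbhs_nbhs.
  by near=> y; rewrite !nO //; near: y.
have cux : u @ within (closure Omega) (nbhs x) --> u x.
  by have := cu x; rewrite /continuous_at nbhs_subspace_in.
have ux : u x = ext Omega u x.
  rewrite /ext; case: asboolP => // nOx; apply: ub; split => // /interior_subset.
  exact.
rewrite ux in cux; suff : ext Omega u @ x --> ext Omega u x by [].
apply/(@cvgrPdist_lt _ _ _ (nbhs x) _ (ext Omega u) (ext Omega u x)) => e e0.
move/cvgrPdist_lt : cux => /(_ e e0) ce.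
have [Ox|nOx] := pselect (Omega x).
  have nO : nbhs x Omega by exact: open_nbhs_nbhs.
  near=> y; have Oy : Omega y by near: y.
  rewrite [in X in _ - X]/ext asboolT //.
  by move: (subset_closure Oy); near: y.
have ex0 : ext Omega u x = 0 by rewrite /ext asboolF.
near=> y; rewrite [in X in _ - X]/ext; case: asboolP => [Oy|_].
  by move: (subset_closure Oy); near: y.
by rewrite ex0 subrr normr0.
Unshelve. all: by end_near. Qed.

(** Joint continuity in the radius and the point, since the radius moves. *)
Lemma continuous_kelvin (k l : R) (U : V -> R) x : continuous U -> 0 < l -> x != 0 ->
  (fun p : R * V => kelvin k p.1 U p.2) @ (l, x) --> kelvin k l U x.
Proof.
move=> cU l0 x0; have r0 : 0 < enorm x by rewrite enorm_gt0.
have c1 : (fun p : R * V => p.1) @ (l, x) --> l by exact: cvg_fst.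
have c2 : (fun p : R * V => p.2) @ (l, x) --> x by exact: cvg_snd.
have ce : (fun p : R * V => enorm p.2) @ (l, x) --> enorm x.
  exact: (continuous_cvg _ (@continuous_enorm x) c2).
apply: cvgM.
  apply: (@continuous_cvg _ _ _ _ _ _ (fun s : R => s `^ k) (l / enorm x)).
    by apply: continuous_powR; rewrite divr_gt0.
  by apply: cvgM => //; apply: cvgV => //; rewrite gt_eqF.
apply: (continuous_cvg _ (cU (invn l x))); apply: cvgZ => //.
apply: cvgM; first exact: cvgM.
apply: cvgV; first by rewrite gt_eqF // exprn_gt0.
exact: cvgM.
Qed.

End Continuity.

(** * Barriers *)

Section Barriers.
Context {R : realType} {n : nat}.
Local Notation V := 'rV[R]_n.
Implicit Types (x y p v w : V) (u : V -> R).

Lemma norm_le_enorm x : `|x| <= enorm x.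
Proof.
rewrite /Num.Def.normr /= mx_normrE; apply: bigmax_le; first exact: enorm_ge0.
move=> [i j] _ /=; rewrite (ord1 i) -sqrtr_sqr enormE ler_sqrt ?dot_ge0 //.
rewrite /dot (bigD1 j) //= expr2 lerDl.
by apply: sumr_ge0 => l _; rewrite -expr2 sqr_ge0.
Qed.

Lemma sqdistE p x : sqdist p x = enorm (x - p) ^+ 2.
Proof. by rewrite enorm_sqr. Qed.

Lemma sqdist_ge0 p x : 0 <= sqdist p x.
Proof. exact: dot_ge0. Qed.

Lemma sqdist_refl p : sqdist p p = 0.
Proof. by rewrite /sqdist subrr; apply/eqP; rewrite dot_eq0. Qed.

(** The topology of row vectors is given by the sup norm, whereas barriers live
    on Euclidean balls. *)
Lemma nbhs_sqdist p (A : set V) : nbhs p A ->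
  exists2 r : R, 0 < r & forall x, sqdist p x <= r -> A x.
Proof.
move=> /nbhs_ballP [e /= e0 eA]; exists ((e / 2) ^+ 2).
  by rewrite exprn_gt0 // divr_gt0.
move=> x; rewrite sqdistE ler_sqr ?nnegrE ?enorm_ge0 ?divr_ge0 ?(ltW e0) // => xe.
apply: eA; rewrite -ball_normE /= distrC (le_lt_trans (norm_le_enorm _)) // (le_lt_trans xe) //.
by lra.
Qed.

Lemma compact_sqdist p (r : R) : compact [set x | sqdist p x <= r].
Proof.
apply: bounded_closed_compact; last first.
  apply: (@closed_comp _ _ (sqdist p) [set t | t <= r]); last exact: closed_le.
  by move=> y _; exact: continuous_sqdist.
exists (`|p| + Num.sqrt r); split => [|M pM x /= xr]; first exact: num_real.
rewrite -(subrK p x) (le_trans (ler_normD _ _)) // addrC.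
apply: (le_trans _ (ltW pM)); rewrite lerD2l (le_trans (norm_le_enorm _)) //.
by rewrite enormE ler_wsqrtr.
Qed.

Lemma compact_preimage (K : set V) (g : V -> R) (C : set R) : compact K ->
  {within K, continuous g} -> closed C -> compact (K `&` g @^-1` C).
Proof.
move=> cK /continuous_closedP cg cC.
have /closed_subspaceP [W cW WE] := cg C cC.
by rewrite setIC -WE setIC; exact: compact_closedI.
Qed.

Lemma pd_sqdist p i : pd (sqdist p) i = fun x => 2 * dot (x - p) (delta_mx 0 i).
Proof. by apply/funext => x; rewrite /pd; have [_ ->] := is_derive_sqdist p (delta_mx 0 i) x. Qed.

Lemma is_derive_dqd p v w x :
  is_derive x w (fun y => 2 * dot (y - p) v) (2 * dot w v).
Proof.
have := is_derive_mul (is_derive_cst (2 : R) x w) (is_derive_dotl p v w x).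
by rewrite mul0r add0r.
Qed.

Lemma Ck2_sqdist p : Ck 2 setT (sqdist p).
Proof.
split => [x _|v]; first exact: differentiable_sqdist.
have -> : (fun x => 'D_v (sqdist p) x) = (fun x => 2 * dot (x - p) v).
  by apply/funext => x; have [_ ->] := is_derive_sqdist p v x.
split=> [x _|w x _].
  apply: differentiableM; first exact: differentiable_cst.
  by apply: differentiable_dot2 => i; [exact: differentiable_subc|exact: differentiable_cst].
have -> : (fun x => 'D_w (fun y => 2 * dot (y - p) v) x) = cst (2 * dot w v).
  by apply/funext => z; have [_ ->] := is_derive_dqd p v w z.
exact: cst_continuous.
Qed.

Lemma flowQ_sqdist p x : flowQ (sqdist p) x = dot x x * (4 * sqdist p x).
Proof.
congr (_ * _); rewrite mulr_sumr; apply: eq_bigr => i _.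
rewrite pd_sqdist dot_delta; ring.
Qed.

Lemma flowLQ_sqdist (k : R) p x :
  flowLQ k (sqdist p) x (flowM k (sqdist p) x) (flowQ (sqdist p) x).
Proof. exact: (flowLQ_C2 k openT I (Ck2_sqdist p)). Qed.

Lemma flowLQ_ln (k : R) x : x != 0 -> flowLQ k (fun y => ln (enorm y)) x k 1.
Proof.
move=> x0; have r0 : 0 < enorm x by rewrite enorm_gt0.
exists 1, 0, (fun _ _ => 0), (fun _ _ => 0); split.
- have -> : (fun t => ln (enorm (dil x t))) = (fun t => t + ln (enorm x)).
    apply/funext => t; rewrite enorm_dil lnM ?posrE ?expR_gt0 // expRK //.
  exists (fun=> 1); split => //; last exact: is_derive_cst.
  near=> t.
  have := is_deriveD (is_derive_id t (1 : R)) (is_derive_cst (ln (enorm x)) t (1 : R)).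
  by rewrite addr0.
- move=> i j; under eq_fun do rewrite enorm_spin.
  exact: jet2_cst.
- by rewrite big1 ?mulr0 ?addr0 ?add0r ?mulr1 // => i _; rewrite big1.
- rewrite big1 ?mulr0 ?addr0 ?expr1n // => i _; rewrite big1 // => j _.
  by rewrite expr0n.
Unshelve. all: by end_near. Qed.

(** The shape of the barriers on thin layers, s in [0, 1] being the rescaled
    distance to the face where the gap is nonnegative.  It is concave with second
    derivative -1, starts at 1 and reaches 3/2: after rescaling, the concavity
    dominates all other terms, and the growth makes a touching point stay
    away from the far face. *)
Definition profile (s : R) : R := 1 + s - s ^+ 2 / 2.

Lemma profile_le (s : R) : profile s <= 1 + s.
Proof. by rewrite /profile lerBlDr lerDl divr_ge0 ?sqr_ge0. Qed.

Lemma profile_ge1 (s : R) : 0 <= s <= 1 -> 1 <= profile s.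
Proof.
move=> /andP[s0 s1]; have : 0 <= s * (1 - s) by rewrite mulr_ge0 // subr_ge0.
by rewrite /profile expr2; lra.
Qed.

Lemma profile_le32 (s : R) : profile s <= 3 / 2.
Proof. by have := sqr_ge0 (1 - s); rewrite /profile !expr2; lra. Qed.

Lemma profile1 : profile 1 = 3 / 2. Proof. by rewrite /profile; lra. Qed.

Lemma is_derive_profile (s : R) : is_derive s (1 : R) profile (1 - s).
Proof.
have d1 := is_deriveD (is_derive_cst (1 : R) s (1 : R)) (is_derive_id s (1 : R)).
have d2 := is_derive_mul (is_derive_mul (is_derive_id s (1 : R)) (is_derive_id s (1 : R)))
  (is_derive_cst (2^-1 : R) s (1 : R)).
by apply: (is_derive_eq (is_deriveB d1 d2)); rewrite /cst; lra.
Qed.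

Lemma continuous_profile : continuous profile.
Proof.
move=> s; apply: differentiable_continuous; apply/derivable1_diffP.
by have [] := is_derive_profile s.
Qed.

Lemma flowL_profile (k D c : R) (F : V -> R) x M Q : flowLQ k F x M Q ->
  flowL k (fun y => profile (D * (F y - c))) x
    (- (D ^+ 2) * Q + D * (1 - D * (F x - c)) * M).
Proof.
move=> FM.
have dlin (t : R) : is_derive t (1 : R) (fun s : R => D * (s - c)) D.
  have := is_derive_mul (is_derive_cst D t (1 : R))
    (is_deriveB (is_derive_id t (1 : R)) (is_derive_cst c t (1 : R))).
  by rewrite mul0r add0r subr0 mulr1.
have dG (t : R) : is_derive t (1 : R) (fun s => profile (D * (s - c))) (D * (1 - D * (t - c))).
  rewrite mulrC.
  exact: (@is_derive1_comp R profile (fun s => D * (s - c)) t _ _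
    (is_derive_profile (D * (t - c))) (dlin t)).
have dG1 (t : R) : is_derive t (1 : R) (fun t => D * (1 - D * (t - c))) (- D ^+ 2).
  have := is_derive_mul (is_derive_cst D t (1 : R))
    (is_deriveB (is_derive_cst (1 : R) t (1 : R)) (dlin t)).
  by rewrite mul0r !add0r mulrN -expr2.
have nG : \forall s \near F x,
    is_derive s (1 : R) (fun s => profile (D * (s - c))) (D * (1 - D * (s - c))).
  by near=> s; exact: dG.
eexists; exact: (flowLQ_comp FM nG (dG1 (F x))).
Unshelve. all: by end_near. Qed.

Lemma profile_start (s t : R) : s < 1 / 10 -> t < 1 / 10 -> profile s + t <= 6 / 5.
Proof. by have := profile_le s; lra. Qed.

Lemma profile_end (t : R) : 0 <= t -> 5 / 4 <= profile 1 + t.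
Proof. by rewrite profile1; lra. Qed.

Lemma profile_side (s : R) : 0 <= s <= 1 -> 5 / 4 <= profile s + 1.
Proof. by move=> /profile_ge1; lra. Qed.

Lemma tenth_lt1 : 1 / 10 < 1 :> R. Proof. lra. Qed.

Lemma sphere_barrier_neg (k C s D : R) : 0 < k -> 0 < C -> 0 <= s -> D = k + 2 * C + 1 ->
  - (D ^+ 2) * 1 + D * (1 - s) * k + C * profile s < 0.
Proof.
move=> k0 C0 s0 DE.
have D1 : 1 < D by lra.
have h1 : 0 <= D * s * k by rewrite !mulr_ge0 //; lra.
have h2 : C * profile s <= C * (3 / 2) by rewrite ler_pM2l // profile_le32.
have h3 : C * 1 < C * D by rewrite ltr_pM2l.
have -> : D ^+ 2 = D * k + 2 * (C * D) + D by rewrite DE; ring.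
have -> : D * (1 - s) * k = D * k - D * s * k by ring.
by move: (D * k) (D * s * k) (C * D) (C * profile s) h1 h2 h3 => *; lra.
Qed.

(** Q and Me stand for the squared gradient and the operator applied to the
    defining function of Omega, and M2 bounds the operator on the term q,
    which confines the barrier laterally. *)
Lemma boundary_barrier_neg (D c0 M1 M2 C s q Q Me : R) :
  0 < D -> 0 < C -> D * M1 + M2 + 3 * C < D ^+ 2 * c0 -> c0 < Q -> `|Me| < M1 ->
  0 <= s <= 1 -> q <= 1 ->
  - (- D) ^+ 2 * Q + - D * (1 - s) * Me + M2 + C * (profile s + q) < 0.
Proof.
move=> D0 C0 DD Qc Mb /andP[s0 s1] q1.
have h1 : - (1 - s) * Me <= M1.
  rewrite (le_trans (ler_norm _)) // normrM normrN -[M1]mul1r.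
  by apply: ler_pM => //; [rewrite ler_norml; lra|exact: ltW].
have h2 : D * (- (1 - s) * Me) <= D * M1 by rewrite ler_pM2l.
have h3 : D ^+ 2 * c0 < D ^+ 2 * Q by rewrite ltr_pM2l // exprn_gt0.
have h4 : C * (profile s + q) <= C * 3.
  by rewrite ler_pM2l //; have := profile_le32 s; lra.
rewrite sqrrN mulNr; have -> : - D * (1 - s) * Me = D * (- (1 - s) * Me) by ring.
move: DD h2 h3 h4; move: (D ^+ 2 * c0) (D ^+ 2 * Q) (D * M1) (D * _) (C * (profile s + q)).
by move=> *; lra.
Qed.

Lemma barrier_slope (c0 M1 M2 C : R) : 0 < c0 -> 0 < M1 -> 0 < M2 -> 0 < C ->
  exists2 D, 0 < D & D * M1 + M2 + 3 * C < D ^+ 2 * c0.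
Proof.
move=> c00 M10 M20 C0; pose E := M1 + (M2 + 3 * C).
have E0 : 0 < E by rewrite /E; lra.
exists (E / c0 + 1); first by rewrite ltr_wpDl // divr_ge0 ?ltW.
set D := _ + 1; have D1 : 1 < D by rewrite ltrDr divr_gt0.
have e1 : D * c0 = E + c0 by rewrite mulrDl mul1r divfK // gt_eqF.
have e2 : D * E < D * (E + c0) by rewrite ltr_pM2l ?ltrDl; lra.
have e3 : 1 * (M2 + 3 * C) < D * (M2 + 3 * C) by rewrite ltr_pM2r //; lra.
have e4 : D * E = D * M1 + D * (M2 + 3 * C) by rewrite mulrDr.
by rewrite expr2 -mulrA e1; lra.
Qed.

Lemma sqdist_sym p x : sqdist p x = sqdist x p.
Proof. by rewrite !sqdistE -opprB -scaleN1r enormZ normrN1 mul1r. Qed.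

Lemma sqdist_triangle p x y : sqdist p x <= 2 * sqdist y x + 2 * sqdist p y.
Proof.
rewrite /sqdist /dot !mulr_sumr -big_split /=; apply: ler_sum => i _.
rewrite !mxE; have := sqr_ge0 ((x 0 i - y 0 i) - (y 0 i - p 0 i)); rewrite expr2.
by move: (x 0 i) (y 0 i) (p 0 i) => b c d; lra.
Qed.

(** Hopf's barrier; the bracket is positive for large al wherever Q is bounded
    away from 0. *)
Lemma flowL_expbarrier (k e al c : R) (F : V -> R) x M Q : flowLQ k F x M Q ->
  flowL k (fun y => e * (expR (- al * F y) - c)) x
    (e * al * expR (- al * F x) * (al * Q - M)).
Proof.
move=> FM.
have dl (t : R) : is_derive t (1 : R) (fun s : R => - al * s) (- al).
  have := is_derive_mul (is_derive_cst (- al) t (1 : R)) (is_derive_id t (1 : R)).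
  by rewrite mul0r add0r mulr1.
have de (t : R) : is_derive t (1 : R) (fun s => expR (- al * s)) (- al * expR (- al * t)).
  rewrite mulrC; exact: (@is_derive1_comp R expR (fun s => - al * s) t _ _
    (is_derive_expR (- al * t)) (dl t)).
have dG (t : R) : is_derive t (1 : R) (fun s => e * (expR (- al * s) - c))
    (e * (- al * expR (- al * t))).
  have := is_derive_mul (is_derive_cst e t (1 : R))
    (is_deriveB (de t) (is_derive_cst c t (1 : R))).
  by rewrite mul0r add0r subr0.
have dG1 (t : R) : is_derive t (1 : R) (fun s => e * (- al * expR (- al * s)))
    (e * (al ^+ 2 * expR (- al * t))).
  have -> : al ^+ 2 * expR (- al * t) = - al * (- al * expR (- al * t)) by ring.
  have := is_derive_mul (is_derive_cst e t (1 : R))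
    (is_derive_mul (is_derive_cst (- al) t (1 : R)) (de t)).
  by rewrite !mul0r !add0r.
have nG : \forall s \near F x, is_derive s (1 : R) (fun s => e * (expR (- al * s) - c))
    (e * (- al * expR (- al * s))) by near=> s; exact: dG.
have -> : e * al * expR (- al * F x) * (al * Q - M) =
    e * (al ^+ 2 * expR (- al * F x)) * Q + e * (- al * expR (- al * F x)) * M by ring.
eexists; exact: (flowLQ_comp FM nG (dG1 (F x))).
Unshelve. all: by end_near. Qed.

Lemma cvg_sum_ord (F : set_system V) {FF : Filter F} (g : 'I_n -> V -> R)
    (l : 'I_n -> R) :
  (forall i, g i @ F --> l i) -> (fun x => \sum_i g i x) @ F --> \sum_i l i.
Proof.
move=> gl; elim: (index_enum _) => [|i s IH].
  by rewrite big_nil; under eq_fun do rewrite big_nil; exact: cvg_cst.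
by rewrite big_cons; under eq_fun do rewrite big_cons; exact: cvgD.
Qed.

Section C2.
Variables (A : set V) (u : V -> R) (p : V).
Hypotheses (Ap : A p) (u_C2 : Ck 2 A u).

Let cdot : (fun x : V => dot x x) @ p --> dot p p.
Proof.
have -> : (fun x => dot x x) = sqdist 0 by apply/funext => x; rewrite /sqdist subr0.
have -> : dot p p = sqdist 0 p by rewrite /sqdist subr0.
exact: continuous_sqdist.
Qed.

Let cpd i : pd u i @ p --> pd u i p.
Proof. exact/differentiable_continuous/(u_C2.2 _).1. Qed.

Lemma continuous_flowM k : flowM k u @ p --> flowM k u p.
Proof.
have h1 i : pd (pd u i) i @ p --> pd (pd u i) i p by exact: (u_C2.2 _).2.
have h2 i : (fun x : V => x 0 i * pd u i x) @ p --> p 0 i * pd u i p.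
  have hc : {for p, continuous (fun x : V => x 0 i)} by exact: coord_continuous.
  exact: (cvgM hc (@cpd i)).
have c1 : (fun x => \sum_i pd (pd u i) i x) @ p --> \sum_i pd (pd u i) i p.
  exact: cvg_sum_ord h1.
have c2 : (fun x : V => \sum_i x 0 i * pd u i x) @ p --> \sum_i p 0 i * pd u i p.
  exact: cvg_sum_ord h2.
exact: (cvgD (cvgM cdot c1) (cvgM (cvg_cst (k + 2 - n%:R) (F := nbhs p)) c2)).
Qed.

Lemma continuous_flowQ : flowQ u @ p --> flowQ u p.
Proof.
have h i : (fun x => pd u i x ^+ 2) @ p --> pd u i p ^+ 2 by exact: (cvgM (@cpd i) (@cpd i)).
have c : (fun x => \sum_i pd u i x ^+ 2) @ p --> \sum_i pd u i p ^+ 2.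
  exact: cvg_sum_ord h.
exact: (cvgM cdot c).
Qed.

End C2.

End Barriers.

(** * The Kelvin transform of a solution is a supersolution *)

Section Solution.
Context {R : realType} {n : nat} (a : R) (Omega : set 'rV[R]_n).
Context (f : 'rV[R]_n -> R -> R) (u : 'rV[R]_n -> R).
Local Notation V := 'rV[R]_n.
Local Notation k := (n%:R - 2 + a).
Local Notation U := (ext Omega u).
Implicit Types (l : R) (x y z p : V) (phi : V -> R).
Hypothesis k_gt0 : 0 < k.
Hypothesis Omega_open : open Omega.
Hypothesis Omega_bounded : bounded_set Omega.
Hypothesis Omega_star : star_shaped0 Omega.
Hypothesis f_adm : admissible a Omega f.
Hypothesis f_scaling : forall (x : V) (y : R), punctured Omega x -> 0 <= y ->
  forall mu nu : R, 1 <= mu -> mu <= nu ->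
    mu `^ (- ((n%:R + 2 - a) / k)) * f (mu `^ (- (2 / k)) *: x) (mu * y)
    <= nu `^ (- ((n%:R + 2 - a) / k)) * f (nu `^ (- (2 / k)) *: x) (nu * y).
Hypothesis u_sol : positive_solution a Omega f u.

Lemma compact_closure : compact (closure Omega).
Proof.
apply: bounded_closed_compact; last exact: closed_closure.
have [M [Mr OM]] := Omega_bounded; exists M; split => // N MN x clx.
have cB : closed [set y : V | `|y| <= N].
  apply: (@closed_comp _ _ (fun y : V => `|y|) [set t | t <= N]).
    by move=> y _; exact: norm_continuous.
  exact: closed_le.
have /closure_subset : Omega `<=` [set y : V | `|y| <= N] by move=> y Oy; exact: (OM N).
by rewrite -((closure_id _).1 cB) => /(_ x clx).
Qed.

Lemma extE x : Omega x -> U x = u x. Proof. by move=> Ox; rewrite /ext asboolT. Qed.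

Lemma ext_out x : ~ Omega x -> U x = 0. Proof. by move=> Ox; rewrite /ext asboolF. Qed.

Lemma ext_gt0 x : Omega x -> 0 < U x.
Proof. by move=> Ox; rewrite extE //; exact: (sol_pos u_sol). Qed.

Lemma ext_ge0 x : 0 <= U x.
Proof.
have [Ox|nOx] := pselect (Omega x); first exact/ltW/ext_gt0.
by rewrite ext_out.
Qed.

Lemma continuous_U : continuous U.
Proof.
by apply: continuous_ext => //; [exact: (sol_C0 u_sol)|exact: (sol_bdry u_sol)].
Qed.

Lemma kelvin_ge0 l x : 0 <= kelvin k l U x.
Proof. by rewrite mulr_ge0 ?powR_ge0 ?ext_ge0. Qed.

Lemma open_punctured : open (punctured Omega).
Proof.
rewrite /punctured setDE; apply: openI => //; rewrite openC; apply: accessible_closed_set1.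
exact/hausdorff_accessible/norm_hausdorff.
Qed.

Lemma flowL_U x : Omega x -> x != 0 ->
  flowL k U x (- (enorm x `^ (2 - a) * f x (U x))).
Proof.
move=> Ox x0; have Px : punctured Omega x by split => //; apply/eqP.
have := flowLQ_C2 k open_punctured Px (sol_C2 u_sol).
have := sol_eq u_sol Px; rewrite (diverg_flow _ open_punctured Px (sol_C2 u_sol) x0).
move: (flowM k u x) => M eqM fM; exists (flowQ u x).
apply: (@flowLQ_near _ _ _ u).
  have nO : \forall y \near x, Omega y by exact: open_nbhs_nbhs.
  by near=> y; rewrite extE //; near: y.
rewrite extE //; suff <- : M = - (enorm x `^ (2 - a) * f x (u x)) by [].
have -> : f x (u x) = - (enorm x `^ (a - 2) * M) by lra.
rewrite mulrN opprK mulrA -powRD; last first.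
  by rewrite (gt_eqF (_ : 0 < enorm x)) ?implybT // enorm_gt0.
by have -> : 2 - a + (a - 2) = 0 by [ring]; rewrite powRr0 mul1r.
Unshelve. all: by end_near. Qed.

Lemma Omega_invn l x : 0 < l -> l <= enorm x -> Omega x -> Omega (invn l x).
Proof.
move=> l0 lx Ox; apply: Omega_star => //.
have r0 : 0 < enorm x by exact: lt_le_trans lx.
rewrite divr_ge0 ?sqr_ge0 //= ler_pdivrMr ?exprn_gt0 // mul1r.
by rewrite ler_sqr ?nnegrE ?(ltW l0) ?(ltW r0).
Qed.

Definition gap (l : R) (x : V) : R := kelvin k l U x - U x.

(** The assumption on f is applied at the point x and the value v_l(x), with
    mu = 1 and nu = (|x| / l)^k: then nu^(-2/k) x is the inverted point and
    nu v_l(x) is the value of U there. *)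
Lemma flowL_gap l x : 0 < l -> l < enorm x -> Omega x ->
  exists2 M, flowL k (gap l) x M &
    M <= enorm x `^ (2 - a) * (f x (U x) - f x (kelvin k l U x)).
Proof.
move=> l0 lx Ox; have r0 : 0 < enorm x by exact: lt_trans lx.
have x0 : x != 0 by rewrite -enorm_gt0.
have Oi := Omega_invn l0 (ltW lx) Ox; have i0 := invn_neq0 l0 x0.
(* All powers of l / |x| are written as exponentials of multiples of t. *)
have [t [t0 tE]] : exists t, 0 < t /\ l = expR (- t) * enorm x.
  exists (ln (enorm x / l)); rewrite ln_gt0 ?ltr_pdivlMr ?mul1r //; split => //.
  by rewrite expRN lnK ?posrE ?divr_gt0 // invf_div mulfVK ?gt_eqF.
have lr : l / enorm x = expR (- t) by rewrite tE mulfK // gt_eqF.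
set c := (l / enorm x) `^ k; set xb := invn l x.
have cE : c = expR (- t * k) by rewrite /c lr expRM.
set v := kelvin k l U x.
have vE : v = c * U xb by [].
set mu := expR (t * k).
have muc : mu * c = 1 by rewrite cE -expRD mulNr subrr expR0.
have mu1 : 1 <= mu by rewrite -expR0 ler_expR ltW // mulr_gt0.
have kN0 : k != 0 by rewrite gt_eqF.
have := f_scaling (conj Ox (elimN eqP x0)) (kelvin_ge0 l x) (lexx 1) mu1.
rewrite !powR1 !mul1r scale1r -/v.
have -> : mu `^ (- (2 / k)) *: x = xb.
  rewrite /xb /invn -expr_div_n lr -expRM -expRM_natl; congr (expR _ *: _).
  by field.
have -> : mu * v = U xb by rewrite vE mulrA muc mul1r.
move=> fsc.
have FM := flowLB (flowL_kelvin l0 x0 (flowL_U Oi i0)) (flowL_U Ox x0).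
eexists; first exact: FM.
rewrite -/c -/xb mulrBr opprK [leLHS]addrC lerD2l mulrN lerN2 mulrA.
(* The exponents agree because k + 2 (2 - a) = n + 2 - a. *)
have -> : c * enorm xb `^ (2 - a) = enorm x `^ (2 - a) * mu `^ (- ((n%:R + 2 - a) / k)).
  have -> : enorm xb = expR (- t * 2) * enorm x.
    rewrite enorm_invn // {1}tE expRM_natr; move: (expR _) => s.
    by field; rewrite gt_eqF.
  rewrite powRM ?expR_ge0 ?enorm_ge0 // -!expRM mulrA cE -expRD mulrC; congr (_ * expR _).
  by field.
by rewrite -mulrA ler_wpM2l ?powR_ge0.
Qed.

Lemma gap_flow_le0 l x : 0 < l -> l < enorm x -> Omega x -> 0 <= gap l x ->
  exists2 M, flowL k (gap l) x M & M <= 0.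
Proof.
move=> l0 lx Ox gx; have [M FM ML] := flowL_gap l0 lx Ox.
have x0 : x != 0 by rewrite -enorm_gt0 (lt_trans l0).
exists M => //; apply: le_trans ML _.
rewrite pmulr_rle0 ?subr_le0; last by rewrite powR_gt0 // enorm_gt0.
apply: (adm_mono f_adm); last by rewrite -subr_ge0.
  by split => //; apply/eqP.
exact: ext_ge0.
Qed.

Lemma enorm_bound : exists2 r : R, 0 < r & forall x, Omega x -> enorm x <= r.
Proof.
have cw : {within closure Omega, continuous (@enorm R n)}.
  exact/continuous_subspaceT/continuous_enorm.
have [E0|/set0P E0] := eqVneq (closure Omega) set0.
  by exists 1 => // x /subset_closure; rewrite E0.
have [c _ cmax] := compact_EVT_max E0 compact_closure cw.
exists (enorm c + 1); first by rewrite ltr_wpDl ?enorm_ge0.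
move=> x /subset_closure Ox; have := cmax x; rewrite inE => /(_ Ox) h.
by rewrite (le_trans h) // lerDl.
Qed.

Lemma U_bound : exists2 B : R, 0 < B & forall x, U x <= B.
Proof.
have cw : {within closure Omega, continuous U}.
  exact/continuous_subspaceT/continuous_U.
have [E0|/set0P E0] := eqVneq (closure Omega) set0.
  exists 1 => // x; rewrite ext_out // => /subset_closure.
  by rewrite E0.
have [c _ cmax] := compact_EVT_max E0 compact_closure cw.
exists (U c + 1); first by rewrite ltr_wpDl ?ext_ge0.
move=> x; have [Ox|nOx] := pselect (Omega x); last by rewrite ext_out // addr_ge0 // ext_ge0.
have := cmax x; rewrite inE => /(_ (subset_closure Ox)) h.
by rewrite (le_trans h) // lerDl.
Qed.

Definition touch_const (C : R) : Prop :=
  forall l x m phi M, 0 < l -> l < enorm x -> Omega x -> 0 < m ->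
    flowL k phi x M -> 0 < phi x -> gap l x + m * phi x = 0 ->
    (\forall y \near x, 0 <= gap l y + m * phi y) -> 0 <= M + C * phi x.

(** At the touching point U - v_l = m phi > 0, so the difference of the values of
    f is at most L |x|^b0 m phi.  The weight |x|^(2 - a + b0) is bounded on Omega,
    even near the origin, because b0 > a - 2; thus C is independent of l. *)
Lemma gap_touch : exists2 C : R, 0 < C & touch_const C.
Proof.
have [r r0 Or] := enorm_bound; have [B B0 UB] := U_bound.
have [b0 [ab0 _ lip]] := adm_lipschitz f_adm.
have [L [L0 fL]] : exists L : R, 0 < L /\ forall x s t, punctured Omega x ->
    `[0, B]%classic s -> `[0, B]%classic t -> `|f x s - f x t| <= L * enorm x `^ b0 * `|s - t|.
  apply: lip; first exact: segment_compact.
  by move=> s /=; rewrite in_itv /= => /andP[].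
exists (L * r `^ (2 - a + b0)); first by rewrite mulr_gt0 ?powR_gt0.
move=> l x m phi M l0 lx Ox m0 FM p0 touch nearx.
have e0 : 0 < enorm x by exact: lt_trans lx.
have x0 : x != 0 by rewrite -enorm_gt0.
have [G FG GL] := flowL_gap l0 lx Ox.
have GM : 0 <= G + m * M.
  apply: (flowL_locmin (flowLD FG (flowLZ m FM))).
  by rewrite touch.
have UvE : U x - kelvin k l U x = m * phi x by move: touch; rewrite /gap; lra.
have mp : 0 < m * phi x by rewrite mulr_gt0.
have v0 := kelvin_ge0 l x; have UB' := UB x.
have := fL x (U x) (kelvin k l U x) (conj Ox (elimN eqP x0)).
rewrite /= !in_itv /= v0 ext_ge0 UB' /= => /(_ isT) lipx.
have {}lipx : f x (U x) - f x (kelvin k l U x) <= L * enorm x `^ b0 * (m * phi x).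
  have vB : kelvin k l U x <= B by lra.
  by rewrite (le_trans (ler_norm _)) // (le_trans (lipx vB)) // UvE gtr0_norm.
have : G <= L * r `^ (2 - a + b0) * (m * phi x).
  apply: (le_trans GL).
  apply: (@le_trans _ _ (enorm x `^ (2 - a) * (L * enorm x `^ b0 * (m * phi x)))).
    by rewrite ler_wpM2l ?powR_ge0.
  have -> : enorm x `^ (2 - a) * (L * enorm x `^ b0 * (m * phi x)) =
      L * enorm x `^ (2 - a + b0) * (m * phi x).
    rewrite (@powRD _ _ (2 - a) b0); last by rewrite (gt_eqF e0) implybT.
    by move: (_ `^ _) (_ `^ _) => s t; ring.
  rewrite ler_wpM2r ?(ltW mp) // ler_wpM2l ?(ltW L0) //.
  apply: ge0_ler_powR; rewrite ?nnegrE ?enorm_ge0 ?(ltW r0) ?Or //; lra.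
move=> Gle; have : 0 <= m * (M + L * r `^ (2 - a + b0) * phi x).
  apply: (le_trans GM); rewrite mulrDr addrC lerD2l (le_trans Gle) //.
  by move: (_ `^ _) => s; lra.
by rewrite pmulr_rge0.
Qed.

(** * Excluding negative minima in thin layers *)

Lemma cvg_gap l x : 0 < l -> x != 0 ->
  (fun p : R * V => gap p.1 p.2) @ (l, x) --> gap l x.
Proof.
move=> l0 x0; apply: cvgB; first exact: (@continuous_kelvin _ _ _ _ _ _ continuous_U l0 x0).
by apply: (continuous_cvg _ (@continuous_U x)); exact: cvg_snd.
Qed.

Lemma continuous_gap l x : 0 < l -> x != 0 -> {for x, continuous (gap l)}.
Proof.
move=> l0 x0; have cp : (fun y : V => (l, y)) @ x --> (l, x).
  have c1 : (fun _ : V => l) @ x --> l by exact: (cvg_cst l (F := nbhs x)).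
  have c2 : (fun y : V => y) @ x --> x by exact: cvg_id.
  exact: (cvg_pair c1 c2).
exact: (cvg_comp _ _ cp (cvg_gap l0 x0)).
Qed.

Lemma gap_sphere l x : 0 < l -> enorm x = l -> gap l x = 0.
Proof.
move=> l0 xl; have lN : l != 0 by rewrite gt_eqF.
rewrite /gap /kelvin /invn xl !divff // ?expf_neq0 //.
by rewrite powR1 mul1r scale1r subrr.
Qed.

Lemma gap_out l x : ~ Omega x -> 0 <= gap l x.
Proof. by move=> Ox; rewrite /gap (ext_out Ox) subr0 kelvin_ge0. Qed.

Definition negmin l x : Prop := [/\ Omega x, l < enorm x, gap l x < 0 &
  forall y, Omega y -> l < enorm y -> gap l x <= gap l y].

(** Let m be the largest value of - gap / phi on B.  Where phi >= 5/4 this value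
    cannot be attained, as - gap is at most its value at x1 and phi x1 <= 6/5.
    At any other point of B where it is attained, the operator inequality
    contradicts [touch_const]. *)
Lemma barrier C l x1 (B : set V) phi : touch_const C -> 0 < l -> negmin l x1 ->
  compact B -> B x1 -> (forall x, B x -> l <= enorm x) ->
  (forall x, B x -> 0 < phi x) -> (forall x, B x -> {for x, continuous phi}) ->
  phi x1 <= 6 / 5 ->
  (forall x, B x -> Omega x -> l < enorm x -> 5 / 4 <= phi x \/
     nbhs x B /\ exists2 M, flowL k phi x M & M + C * phi x < 0) -> False.
Proof.
move=> tC l0 [Ox1 lx1 g1 gmin] cB B1 Bl phi0 cphi phi1 alt.
have nz x : B x -> x != 0.
  by move=> /Bl lx; rewrite -enorm_gt0 (lt_le_trans l0).
have cw : {within B, continuous (fun x => gap l x / phi x)}.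
  apply: continuous_in_subspaceT => x; rewrite inE => Bx.
  have c1 := continuous_gap l0 (nz _ Bx).
  have c2 : (fun y => (phi y)^-1) @ x --> (phi x)^-1.
    have pN0 : phi x != 0 by rewrite gt_eqF // phi0.
    exact: (cvgV pN0 (cphi _ Bx)).
  exact: (cvgM c1 c2).
have [x2 + xmin] := compact_EVT_min (ex_intro _ x1 B1) cB cw; rewrite inE => B2.
have {}xmin y : B y -> gap l x2 / phi x2 <= gap l y / phi y.
  by move=> By; apply: xmin; rewrite inE.
set m := - (gap l x2 / phi x2).
have m1 : - gap l x1 <= m * phi x1.
  have := xmin _ B1; rewrite ler_pdivlMr ?phi0 //.
  by rewrite /m mulNr lerN2.
have m0 : 0 < m.
  rewrite -(pmulr_lgt0 _ (phi0 _ B1)); apply: lt_le_trans m1.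
  by rewrite oppr_gt0.
have g2 : gap l x2 = - (m * phi x2).
  by rewrite /m mulNr opprK divfK // gt_eqF // phi0.
have g20 : gap l x2 < 0 by rewrite g2 oppr_lt0 mulr_gt0 // phi0.
have O2 : Omega x2.
  by apply: contrapT => /(gap_out l); rewrite leNgt g20.
have l2 : l < enorm x2.
  rewrite lt_neqAle Bl // andbT; apply/eqP => /esym /(gap_sphere l0) g20'.
  by move: g20; rewrite g20' ltxx.
have [p54|[nB [M FM ML]]] := alt _ B2 O2 l2.
  have := gmin _ O2 l2; rewrite g2.
  have : m * (5 / 4) <= m * phi x2 by rewrite ler_pM2l.
  have : m * phi x1 <= m * (6 / 5) by rewrite ler_pM2l.
  by move: m1; move: (m * phi x1) (m * phi x2) => ? ?; lra.
have := tC l x2 m phi M l0 l2 O2 m0 FM (phi0 _ B2).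
rewrite leNgt ML => touch; suff : false by []; apply: touch.
  by rewrite g2 addNr.
near=> y; have By : B y by near: y.
have := xmin _ By; rewrite ler_pdivlMr ?phi0 // -[X in X * _]opprK -/m mulNr.
by rewrite -subr_ge0 opprK.
Unshelve. all: by end_near. Qed.

Lemma compact_shell (l r : R) : compact [set x : V | l <= enorm x <= r].
Proof.
apply: bounded_closed_compact.
  exists `|r|; split => [|M rM x /= /andP[_ xr]]; first exact: num_real.
  rewrite (le_trans (norm_le_enorm x)) // (le_trans xr) //.
  by rewrite (le_trans (ler_norm _)) // ltW.
have -> : [set x : V | l <= enorm x <= r] = @enorm R n @^-1` `[l, r]%classic.
  by apply/seteqP; split => x /=; rewrite in_itv.
apply: (@closed_comp _ _ (@enorm R n)); last exact: itv_closed.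
by move=> y _; exact: continuous_enorm.
Qed.

(** The barrier is the profile of D ln(|x| / l), and ln |x| is affine along
    dilations and constant along rotations.  It uses the whole shell
    l <= |x| <= l e^(1/D), since the gap is nonnegative outside Omega. *)
Lemma no_negmin_sphere C l0 p : 0 < C -> touch_const C -> 0 < l0 -> enorm p = l0 ->
  \forall x \near p & l \near l0, ~ negmin l x.
Proof.
move=> C0 tC l00 pl0.
pose D := k + 2 * C + 1.
have D0 : 0 < D by rewrite /D ltr_wpDl // addr_ge0 ?(ltW k_gt0) // mulr_ge0 // ltW.
have cs : (fun q : V * R => D * (ln (enorm q.1) - ln q.2)) @ (p, l0) --> 0.
  have -> : 0 = D * (ln (enorm p) - ln l0) by rewrite pl0 subrr mulr0.
  apply: cvgM; first exact: cvg_cst.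
  have ln_c (t : R) : 0 < t -> {for t, continuous (@ln R)} by exact: continuous_ln.
  apply: cvgB.
    have p0 : 0 < enorm p by rewrite pl0.
    apply: (continuous_cvg _ (ln_c _ p0)).
    by apply: (continuous_cvg _ (@continuous_enorm _ _ p)); exact: cvg_fst.
  by apply: (continuous_cvg _ (ln_c _ l00)); exact: cvg_snd.
have ns : \forall q \near (p, l0), D * (ln (enorm q.1) - ln q.2) < 1 / 10 /\ 0 < q.2.
  near=> q; split; near: q.
    by apply: (cs [set t | t < 1 / 10]); exact: lt_nbhsl.
  have c2 : (fun q : V * R => q.2) @ (p, l0) --> l0 by exact: cvg_snd.
  by apply: (c2 [set t | 0 < t]); exact: lt_nbhsr.
apply: filterS ns => -[x1 l] /= [s1 lpos] nm; have [Ox1 lx1 _ _] := nm.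
pose phi x := profile (D * (ln (enorm x) - ln l)).
pose B := [set x : V | l <= enorm x <= l * expR D^-1].
have lnl x : 0 < enorm x -> (0 <= D * (ln (enorm x) - ln l)) = (l <= enorm x).
  by move=> x0; rewrite pmulr_rge0 // subr_ge0 ler_ln ?posrE.
have lnr x : 0 < enorm x ->
    (D * (ln (enorm x) - ln l) <= 1) = (enorm x <= l * expR D^-1).
  move=> x0; rewrite mulrC -ler_pdivlMr // mul1r lerBlDl -{1}(expRK D^-1).
  by rewrite -lnM ?ler_ln ?posrE ?mulr_gt0 ?expR_gt0.
have Bpos x : B x -> 0 < enorm x by move=> /andP[lx _]; exact: lt_le_trans lx.
have sB x : B x -> 0 <= D * (ln (enorm x) - ln l) <= 1.
  by move=> Bx; rewrite lnl ?lnr ?Bpos.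
have x10 : 0 < enorm x1 by exact: lt_trans lx1.
apply: (@barrier C l x1 B phi tC lpos nm).
- exact: compact_shell.
- by rewrite /B /= ltW //= -lnr // ltW // (lt_trans s1) // ltr_pdivrMr // mul1r ltr1n.
- by move=> x /andP[].
- by move=> x /sB /profile_ge1; exact: lt_le_trans.
- move=> x Bx; have ce : {for x, continuous (@enorm R n)} by exact: continuous_enorm.
  have cl : (fun y : V => ln (enorm y)) @ x --> ln (enorm x).
    exact: (continuous_cvg _ (continuous_ln (Bpos _ Bx)) ce).
  have cD : (fun y : V => D * (ln (enorm y) - ln l)) @ x --> D * (ln (enorm x) - ln l).
    exact: (cvgM (cvg_cst D (F := nbhs x)) (cvgB cl (cvg_cst (ln l) (F := nbhs x)))).
  have cb : {for D * (ln (enorm x) - ln l), continuous (@profile R)} by exact: continuous_profile.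
  exact: (continuous_cvg _ cb cD).
- by rewrite -[phi x1]addr0; exact: profile_start.
move=> x Bx Ox lx; have := sB _ Bx => /andP[s0 s1'].
have x0 := Bpos _ Bx.
have [sE|sN] := eqVneq (D * (ln (enorm x) - ln l)) 1.
  by left; rewrite /phi sE -[profile 1]addr0; exact: profile_end.
right; split.
  have sl : enorm x < l * expR D^-1.
    rewrite lt_neqAle -lnr // s1' andbT; apply: contra_neq sN => ->.
    rewrite lnM ?posrE ?expR_gt0 // expRK [ln l + _]addrC addrK divff // gt_eqF //.
  have n1 : \forall y \near x, l < enorm y.
    by apply: (@continuous_enorm _ _ x [set t | l < t]); exact: lt_nbhsr.
  have n2 : \forall y \near x, enorm y < l * expR D^-1.
    by apply: (@continuous_enorm _ _ x [set t | t < _]); exact: lt_nbhsl.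
  near=> y; apply/andP; split; apply: ltW; near: y; [exact: n1|exact: n2].
have xN0 : x != 0 by rewrite -enorm_gt0.
eexists; first exact: (flowL_profile D (ln l) (flowLQ_ln k xN0)).
exact: sphere_barrier_neg.
Unshelve. all: by end_near. Qed.

(** Near p, Omega is {eta < 0} with eta of nonvanishing gradient.  The barrier is
    the profile of - D eta on the layer -1/D <= eta <= 0 plus |x - p|^2 / r: on
    the lateral face |x - p|^2 = r this last term alone adds 1.  The bounds on the
    derivatives are fixed before D is chosen, and D is large. *)
Lemma no_negmin_boundary C l0 p : 0 < C -> touch_const C -> 0 < l0 ->
  smooth_boundary Omega -> boundary Omega p -> l0 < enorm p ->
  \forall x \near p & l \near l0, ~ negmin l x.
Proof.
move=> C0 tC l00 smooth bp lp.
have [W [eta [[oW Wp] etaC geta etaO]]] := smooth p bp.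
have etaC2 : Ck 2 W eta := etaC 2%N.
have nOp : ~ Omega p.
  by move=> Op; case: bp => _; apply; exact: (open_nbhs_nbhs (conj Omega_open Op)).
have p0 : p != 0 by rewrite -enorm_gt0 (lt_trans l00).
have Q0 : 0 < flowQ eta p.
  have gp := geta p Wp.
  rewrite mulr_gt0 //; first by rewrite lt_neqAle dot_ge0 eq_sym dot_eq0 p0.
  have -> : \sum_i pd eta i p ^+ 2 = dot (grad eta p) (grad eta p).
    by apply: eq_bigr => i _; rewrite mxE expr2.
  by rewrite lt_neqAle dot_ge0 eq_sym dot_eq0 gp.
pose c0 := flowQ eta p / 2.
have c00 : 0 < c0 by rewrite divr_gt0.
pose M1 := `|flowM k eta p| + 1.
pose M2 := `|flowM k (sqdist p) p| + 1.
pose l1 := (l0 + enorm p) / 2.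
have l01 : l0 < l1 by rewrite /l1; lra.
have l1p : l1 < enorm p by rewrite /l1; lra.
have near_abs (h : V -> R) : h @ p --> h p -> \forall x \near p, `|h x| < `|h p| + 1.
  move=> hp; have ha : (fun x => `|h x|) @ p --> `|h p| by exact: (cvg_norm hp).
  by apply: (ha [set t | t < _]); apply: lt_nbhsl; rewrite ltrDl.
have nW : \forall x \near p, [/\ W x, flowQ eta x > c0, `|flowM k eta x| < M1,
    `|flowM k (sqdist p) x| < M2 & l1 < enorm x].
  have w1 : \forall x \near p, W x by exact: open_nbhs_nbhs.
  have w2 : \forall x \near p, flowQ eta x > c0.
    have cQ : flowQ eta @ p --> flowQ eta p by exact: (continuous_flowQ Wp etaC2).
    apply: (cQ [set t | t > c0]).
    by apply: lt_nbhsr; rewrite /c0; lra.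
  have w3 : \forall x \near p, `|flowM k eta x| < M1.
    by apply: near_abs; exact: (continuous_flowM Wp etaC2).
  have w4 : \forall x \near p, `|flowM k (sqdist p) x| < M2.
    by apply: near_abs; exact: (continuous_flowM (A := setT) (p := p) I (Ck2_sqdist p)).
  have w5 : \forall x \near p, l1 < enorm x.
    by apply: (@continuous_enorm _ _ p [set t | l1 < t]); exact: lt_nbhsr.
  by near=> x; split; near: x.
have [r r0 rW] := nbhs_sqdist nW.
have M10 : 0 < M1 by rewrite ltr_wpDl.
have M2r : 0 < M2 / r by rewrite divr_gt0 // ltr_wpDl.
have [D D0 DD] := barrier_slope c00 M10 M2r C0.
have DN0 : D != 0 by rewrite gt_eqF.
have ceta x : W x -> {for x, continuous eta}.
  by move=> Wx; apply: differentiable_continuous; exact: etaC2.1.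
(* p is not in Omega, hence eta p >= 0 and eta is almost nonnegative nearby. *)
have etap : 0 <= eta p by rewrite leNgt; apply/negP => /(etaO p Wp).
have ns : \forall x \near p & l \near l0,
    [/\ sqdist p x < r / 10, - (1 / 10 / D) < eta x, W x, 0 < l & l < l1].
  have n1 : \forall x \near p, sqdist p x < r / 10.
    apply: (@continuous_sqdist _ _ p p [set t | t < r / 10]).
    by apply: lt_nbhsl; rewrite sqdist_refl divr_gt0.
  have n2 : \forall x \near p, - (1 / 10 / D) < eta x.
    apply: (ceta p Wp [set t | - (1 / 10 / D) < t]); apply: lt_nbhsr.
    by apply: lt_le_trans etap; rewrite oppr_lt0 !divr_gt0.
  have n3 : \forall x \near p, W x by exact: open_nbhs_nbhs.
  have n4 : \forall l \near l0, 0 < l by exact: lt_nbhsr.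
  have n5 : \forall l \near l0, l < l1 by exact: lt_nbhsl.
  exists ([set x | [/\ sqdist p x < r / 10, - (1 / 10 / D) < eta x & W x]],
    [set l | 0 < l /\ l < l1]) => /=.
    by split; near=> z; split; near: z.
  by move=> [x l] /= [[? ? ?] [? ?]]; split.
apply: filterS ns => -[x1 l] /= [q1 s1 Wx1 lpos ll1] nm; have [Ox1 lx1 _ _] := nm.
pose phi x := profile (- D * (eta x - 0)) + r^-1 * sqdist p x.
pose B := [set x | sqdist p x <= r] `&` eta @^-1` `[- D^-1, 0]%classic.
have BE x : B x <-> sqdist p x <= r /\ 0 <= - D * (eta x - 0) <= 1.
  have -> : (0 <= - D * (eta x - 0) <= 1) = (- D^-1 <= eta x <= 0).
    rewrite subr0 mulNr oppr_ge0 pmulr_rle0 // andbC; congr (_ && _).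
    by rewrite lerNl -[RHS](ler_pM2l D0) mulrN divff.
  by rewrite /B /= in_itv.
have qr x : 0 <= r^-1 * sqdist p x by rewrite mulr_ge0 ?sqdist_ge0 // invr_ge0 ltW.
have qr1 x : sqdist p x <= r -> r^-1 * sqdist p x <= 1.
  by move=> qx; rewrite mulrC ler_pdivrMr // mul1r.
have ex1 : eta x1 < 0 by apply: (etaO x1 Wx1).1.
have sD : 0 <= - D * (eta x1 - 0) < 1 / 10.
  rewrite subr0 mulNr oppr_ge0 pmulr_rle0 // (ltW ex1) ltrNl.
  have -> : - (1 / 10) = D * - (1 / 10 / D) by field.
  by rewrite ltr_pM2l.
have lt10 := @tenth_lt1 R.
apply: (@barrier C l x1 B phi tC lpos nm).
- apply: compact_preimage; [exact: compact_sqdist| |exact: itv_closed].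
  apply: continuous_in_subspaceT => x; rewrite inE /= => /rW [Wx _ _ _ _].
  exact: ceta.
- apply/BE; split; last by case/andP: sD => -> /ltW/le_trans -> //; exact: ltW.
  by rewrite (le_trans (ltW q1)) // ler_pdivrMr // ler_peMr ?(ltW r0) // ler1n.
- by move=> x /BE[/rW [_ _ _ _ lx] _]; apply: ltW; exact: lt_trans lx.
- move=> x /BE[_ /profile_ge1 b1]; rewrite ltr_pwDl //; exact: lt_le_trans b1.
- move=> x /BE[/rW [Wx _ _ _ _] _].
  have c1 : (fun y => - D * (eta y - 0)) @ x --> - D * (eta x - 0).
    exact: (cvgM (cvg_cst (- D) (F := nbhs x)) (cvgB (ceta x Wx) (cvg_cst 0 (F := nbhs x)))).
  have cb : {for - D * (eta x - 0), continuous (@profile R)} by exact: continuous_profile.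
  have c2 : {for x, continuous (fun y => r^-1 * sqdist p y)}.
    have cq : {for x, continuous (sqdist p)} by exact: continuous_sqdist.
    exact: (cvgM (cvg_cst r^-1 (F := nbhs x)) cq).
  exact: (cvgD (continuous_cvg _ cb c1) c2).
- have q2 : r^-1 * sqdist p x1 < 1 / 10 by rewrite mulrC ltr_pdivrMr // mulrAC mul1r.
  by case/andP: sD => _ sD; exact: profile_start.
move=> x Bx Ox lx; have [qx sx] := (BE x).1 Bx.
have [Wx Qx Mx Mqx l1x] := rW x qx.
have ex : eta x < 0 by apply: (etaO x Wx).1.
have [qE|qN] := eqVneq (sqdist p x) r.
  by left; rewrite /phi qE mulVf ?gt_eqF //; exact: profile_side.
have [sE|sN] := eqVneq (- D * (eta x - 0)) 1.
  by left; rewrite /phi sE; exact: profile_end.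
right; split.
  have n1 : \forall y \near x, sqdist p y < r.
    apply: (@continuous_sqdist _ _ p x [set t | t < r]).
    by apply: lt_nbhsl; rewrite lt_neqAle qN.
  have ceD : (fun y => - D * (eta y - 0)) @ x --> - D * (eta x - 0).
    exact: (cvgM (cvg_cst (- D) (F := nbhs x)) (cvgB (ceta x Wx) (cvg_cst 0 (F := nbhs x)))).
  have n2 : \forall y \near x, - D * (eta y - 0) < 1.
    apply: (ceD [set t | t < 1]); apply: lt_nbhsl; rewrite lt_neqAle sN /=.
    by case/andP: sx.
  have n3 : \forall y \near x, 0 < - D * (eta y - 0).
    apply: (ceD [set t | 0 < t]); apply: lt_nbhsr.
    by rewrite subr0 mulNr oppr_gt0 pmulr_rlt0.
  near=> y; apply/BE; split; first by apply: ltW; near: y.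
  by apply/andP; split; apply: ltW; near: y.
have FQ := flowLZ r^-1 (ex_intro _ _ (flowLQ_sqdist k p x)).
eexists; first exact: (flowLD (flowL_profile (- D) 0 (flowLQ_C2 k oW Wx etaC2)) FQ).
apply: le_lt_trans (boundary_barrier_neg D0 C0 DD Qx Mx sx (qr1 x qx)).
rewrite lerD2r lerD2l mulrC ler_pM2r ?invr_gt0 //.
exact: (le_trans (ler_norm _) (ltW Mqx)).
Unshelve. all: by end_near. Qed.

(** * The strong maximum principle *)

(** The gap exceeds e on a small ball around y.  On the annulus r1 <= |x - y|^2 <= r
    it stays above Hopf's barrier psi, which is at most e on the inner sphere,
    zero on the outer one, and mapped by the operator to a positive value, while
    the operator maps the gap to a nonpositive one: the difference has no
    negative interior minimum. *)
Lemma gap_ball l y (r : R) : 0 < l ->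
  (forall x, Omega x -> l < enorm x -> 0 <= gap l x) ->
  (forall x, sqdist y x <= r -> Omega x /\ l < enorm x) -> 0 < gap l y ->
  forall x, sqdist y x < r -> 0 < gap l x.
Proof.
move=> l0 gap0 ball gy x xr.
have nz z : sqdist y z <= r -> z != 0.
  by move=> /ball[_ lz]; rewrite -enorm_gt0 (lt_trans l0).
have cgap z : sqdist y z <= r -> {for z, continuous (gap l)}.
  by move=> /nz; exact: continuous_gap.
have r0 : 0 < r by exact: le_lt_trans (sqdist_ge0 y x) xr.
pose e := gap l y / 2; have e0 : 0 < e by rewrite divr_gt0.
have ne : \forall z \near y, e < gap l z.
  have qyy : sqdist y y <= r by rewrite sqdist_refl ltW.
  apply: (cgap y qyy [set t | e < t]); apply: lt_nbhsr.
  by rewrite /e ltr_pdivrMr // ltr_pMr // ltr1n.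
have [r1 r10 r1e] := nbhs_sqdist ne.
have [xr1|r1x] := leP (sqdist y x) r1; first exact: (lt_trans e0 (r1e _ xr1)).
pose B := [set z | sqdist y z <= r] `&` sqdist y @^-1` `[r1, r]%classic.
have BE z : B z <-> r1 <= sqdist y z <= r.
  by rewrite /B /= in_itv /=; split => [[_ //]|/[dup] /andP[_ ->]].
have cB : compact B.
  apply: compact_preimage; [exact: compact_sqdist| |exact: itv_closed].
  exact/continuous_subspaceT/continuous_sqdist.
have Bx : B x by apply/BE; rewrite !ltW.
have [K KM] : exists K, forall z, B z -> flowM k (sqdist y) z <= K.
  have cM : {within B, continuous (flowM k (sqdist y))}.
    apply: continuous_subspaceT => z.
    exact: (continuous_flowM (A := setT) (p := z) I (Ck2_sqdist y)).
  have [z _ zmax] := compact_EVT_max (ex_intro _ x Bx) cB cM.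
  by exists (flowM k (sqdist y) z) => w Bw; apply: zmax; rewrite inE.
pose q0 := l ^+ 2 * (4 * r1).
have q00 : 0 < q0 by rewrite !mulr_gt0 // exprn_gt0.
pose al := (`|K| + 1) / q0.
have al0 : 0 < al by rewrite divr_gt0 // ltr_wpDl.
pose psi z := e * (expR (- al * sqdist y z) - expR (- al * r)).
have cpsi : continuous psi.
  move=> z; have cq : {for z, continuous (sqdist y)} by exact: continuous_sqdist.
  have c1 : (fun w => - al * sqdist y w) @ z --> - al * sqdist y z.
    exact: (cvgM (cvg_cst (- al) (F := nbhs z)) cq).
  have ce : {for - al * sqdist y z, continuous (@expR R)} by exact: continuous_expR.
  have c2 : (fun w => expR (- al * sqdist y w)) @ z --> expR (- al * sqdist y z).
    exact: (continuous_cvg _ ce c1).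
  have c3 : (fun w => expR (- al * sqdist y w) - expR (- al * r)) @ z -->
      expR (- al * sqdist y z) - expR (- al * r).
    exact: (cvgB c2 (cvg_cst (expR (- al * r)) (F := nbhs z))).
  exact: (cvgM (cvg_cst e (F := nbhs z)) c3).
have cw : {within B, continuous (fun z => gap l z - psi z)}.
  apply: continuous_in_subspaceT => z; rewrite inE => /BE/andP[_ zr].
  exact: (cvgB (cgap z zr) (@cpsi z)).
have [x2 + xmin] := compact_EVT_min (ex_intro _ x Bx) cB cw; rewrite inE => B2.
have psix : 0 < psi x.
  by rewrite mulr_gt0 // subr_gt0 ltr_expR !mulNr ltrN2 ltr_pM2l.
suff : 0 <= gap l x2 - psi x2.
  have := xmin x; rewrite inE => /(_ Bx) h1 h2.
  by have := le_trans h2 h1; rewrite subr_ge0; exact: lt_le_trans.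
have /andP[r1x2 x2r] := (BE x2).1 B2.
have [Ox2 lx2] := ball _ x2r.
have g2 := gap0 _ Ox2 lx2.
rewrite leNgt; apply/negP => neg.
have [qE|qN] := eqVneq (sqdist y x2) r.
  by move: neg; rewrite /psi qE subrr mulr0 subr0 ltNge g2.
have [q1E|q1N] := eqVneq (sqdist y x2) r1.
  have ge : e < gap l x2 by apply: r1e; rewrite q1E.
  move: neg; rewrite subr_lt0 ltNge => /negP; apply.
  apply: le_trans (ltW ge); rewrite /psi -[leRHS]mulr1 ler_pM2l // lerBlDr.
  rewrite (@le_trans _ _ 1) ?lerDl ?expR_ge0 // expR_le1.
  by rewrite mulNr oppr_le0 mulr_ge0 ?sqdist_ge0 // ltW.
have nB : \forall z \near x2, B z.
  have n1 : \forall z \near x2, r1 < sqdist y z.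
    apply: (@continuous_sqdist _ _ y x2 [set t | r1 < t]); apply: lt_nbhsr.
    by rewrite lt_neqAle eq_sym q1N.
  have n2 : \forall z \near x2, sqdist y z < r.
    apply: (@continuous_sqdist _ _ y x2 [set t | t < r]); apply: lt_nbhsl.
    by rewrite lt_neqAle qN.
  by near=> z; apply/BE/andP; split; apply: ltW; near: z.
have [M FM ML] := gap_flow_le0 l0 lx2 Ox2 g2.
have FP := flowL_expbarrier e al (expR (- al * r)) (flowLQ_sqdist k y x2).
have : 0 <= M - e * al * expR (- al * sqdist y x2) *
    (al * flowQ (sqdist y) x2 - flowM k (sqdist y) x2).
  apply: (flowL_locmin (flowLB FM FP)).
  near=> z; apply: xmin; rewrite inE; near: z; exact: nB.
rewrite leNgt => /negP; apply; rewrite subr_lt0; apply: (le_lt_trans ML).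
apply: mulr_gt0; first exact: mulr_gt0 (mulr_gt0 e0 al0) (expR_gt0 _).
rewrite subr_gt0; apply: (le_lt_trans (KM _ B2)).
apply: (le_lt_trans (ler_norm _)); apply: (@lt_le_trans _ _ (al * q0)).
  by rewrite /al divfK ?ltrDl // gt_eqF.
rewrite ler_pM2l // flowQ_sqdist -enorm_sqr; apply: ler_pM.
- by rewrite sqr_ge0.
- by rewrite mulr_ge0 // ltW.
- by rewrite ler_sqr ?nnegrE ?enorm_ge0 ?(ltW l0) // ltW.
- by rewrite ler_pM2l.
Unshelve. all: by end_near. Qed.

(** The ray through x0 leaves Omega at t0 x0, where U vanishes and v_l does not,
    because the inverted point is on the ray before t0 x0.  If the gap were zero
    somewhere on the segment, take the last such point s x0: a ball around a
    slightly later point contains it, and [gap_ball] applies. *)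
Lemma gap_gt0 l : 0 < l -> (forall x, Omega x -> l < enorm x -> 0 <= gap l x) ->
  forall x, Omega x -> l < enorm x -> 0 < gap l x.
Proof.
move=> l0 gap0 x0 Ox lx; have r0 : 0 < enorm x0 by exact: lt_trans lx.
have xN0 : x0 != 0 by rewrite -enorm_gt0.
have cray : continuous (fun t : R => t *: x0) by exact: scalel_continuous.
pose T := [set t | 1 <= t /\ Omega (t *: x0)].
have T1 : T 1 by rewrite /T /= scale1r.
have supT : has_sup T.
  split; first by exists 1.
  have [r rpos Or] := enorm_bound.
  exists (r / enorm x0) => t [t1 /Or].
  rewrite enormZ ger0_norm; last exact: le_trans t1.
  by rewrite ler_pdivlMr.
pose t0 := sup T.
have t01 : 1 <= t0 by exact: sup_upper_bound.
have t00 : 0 < t0 by exact: lt_le_trans t01.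
have Oray t : 0 <= t -> t < t0 -> Omega (t *: x0).
  move=> tpos; rewrite -subr_gt0 => /sup_adherent /(_ supT) [s [s1 Os]].
  rewrite opprB addrC subrK => ts.
  have s0 : 0 < s by exact: lt_le_trans s1.
  have -> : t *: x0 = (t / s) *: (s *: x0) by rewrite scalerA divfK // gt_eqF.
  apply: Omega_star => //.
  by rewrite divr_ge0 ?(ltW s0) //= ler_pdivrMr // mul1r ltW.
have nOt0 : ~ Omega (t0 *: x0).
  move=> Ot0.
  have nO : \forall t \near t0, Omega (t *: x0).
    exact: (cray t0 _ (open_nbhs_nbhs (conj Omega_open Ot0))).
  have nO' : \forall t \near t0^'+, Omega (t *: x0) /\ t0 < t.
    near=> t; split; near: t; last exact: nbhs_right_gt.
    exact: (cvg_within _ nO).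
  have [t [Ot tt]] := filter_ex nO'.
  have : T t by split => //; rewrite (le_trans t01) // ltW.
  by move=> /(sup_upper_bound supT); rewrite leNgt tt.
have enr t : 0 <= t -> enorm (t *: x0) = t * enorm x0 by move=> ?; rewrite enormZ ger0_norm.
have lray t : 1 <= t -> l < enorm (t *: x0).
  move=> t1; rewrite enr; last exact: le_trans t1.
  by rewrite (lt_le_trans lx) // ler_peMl // ltW.
have gt0' : 0 < gap l (t0 *: x0).
  rewrite /gap (ext_out nOt0) subr0 /kelvin mulr_gt0 //.
    by rewrite powR_gt0 // divr_gt0 // (lt_trans l0) // lray.
  apply: ext_gt0 => //; rewrite /invn scalerA; apply: Oray.
    by rewrite mulr_ge0 ?(ltW t00) // divr_ge0 ?sqr_ge0.
  have l1 := lray _ t01.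
  rewrite -[ltRHS]mul1r ltr_pM2r // ltr_pdivrMr ?mul1r; last first.
    by rewrite exprn_gt0 // (lt_trans l0).
  by rewrite ltr_sqr ?nnegrE ?enorm_ge0 ?(ltW l0).
rewrite ltNge; apply/negP => gx.
pose Z := [set t | [/\ 1 <= t, t <= t0 & gap l (t *: x0) <= 0]].
have Z1 : Z 1 by split => //; rewrite scale1r.
have supZ : has_sup Z by split; [exists 1|exists t0 => t []].
pose s := sup Z.
have s1 : 1 <= s by exact: sup_upper_bound.
have st0 : s <= t0 by apply: ge_sup; [exists 1|move=> t []].
have cg (t : R) : 1 <= t -> {for t, continuous (fun t : R => gap l (t *: x0))}.
  move=> t1; have tz : t *: x0 != 0 by rewrite -enorm_gt0 (lt_trans l0) // lray.
  exact: (continuous_cvg _ (continuous_gap l0 tz) (@cray t)).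
have gs : gap l (s *: x0) <= 0.
  rewrite leNgt; apply/negP => gs.
  have /nbhs_ballP [e /= e0 he] : \forall t \near s, 0 < gap l (t *: x0).
    by apply: (cg s s1 [set t | 0 < t]); exact: lt_nbhsr.
  have [t Zt st] := sup_adherent e0 supZ.
  have ts : t <= s by exact: sup_upper_bound.
  case: Zt => _ _; rewrite leNgt => /negP; apply; apply: he.
  by rewrite /ball /= ger0_norm ?subr_ge0 // ltrBlDr addrC -ltrBlDr.
have sltt : s < t0.
  rewrite lt_neqAle st0 andbT; apply/eqP => stE.
  by move: gs; rewrite stE leNgt gt0'.
have gt_s t : s < t -> t <= t0 -> 0 < gap l (t *: x0).
  move=> st tt; rewrite ltNge; apply/negP => gt.
  have : Z t by split => //; rewrite (le_trans s1) // ltW.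
  by move=> /(sup_upper_bound supZ); rewrite leNgt st.
have Os : Omega (s *: x0) by apply: Oray => //; exact: le_trans s1.
have nD : \forall x \near s *: x0, Omega x /\ l < enorm x.
  near=> x; split; near: x; first exact: open_nbhs_nbhs.
  by apply: (@continuous_enorm _ _ (s *: x0) [set t | l < t]); apply: lt_nbhsr; exact: lray.
have [r rpos rD] := nbhs_sqdist nD.
have nq : \forall t \near s, sqdist (s *: x0) (t *: x0) < r / 4.
  have cq : (fun t : R => sqdist (s *: x0) (t *: x0)) @ s --> sqdist (s *: x0) (s *: x0).
    have c : {for s *: x0, continuous (sqdist (s *: x0))} by exact: continuous_sqdist.
    exact: (continuous_cvg _ c (@cray s)).
  by apply: (cq [set t | t < r / 4]); apply: lt_nbhsl; rewrite sqdist_refl divr_gt0.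
have ex : \forall t \near s^'+, [/\ sqdist (s *: x0) (t *: x0) < r / 4, s < t & t < t0].
  near=> t; split; near: t; [|exact: nbhs_right_gt|exact: nbhs_right_lt].
  exact: (cvg_within _ nq).
have [t [qt stt tt0]] := filter_ex ex.
have gt := gt_s _ stt (ltW tt0).
have := @gap_ball l (t *: x0) (r / 4) l0 gap0 _ gt (s *: x0).
rewrite sqdist_sym => /(_ _ qt) gs'; move: gs; rewrite leNgt gs' // => z zr.
apply: rD; apply: (le_trans (sqdist_triangle (s *: x0) z (t *: x0))).
have -> : r = 2 * (r / 4) + 2 * (r / 4) by field.
by apply: lerD; rewrite ler_pM2l // ltW.
Unshelve. all: by end_near. Qed.

(** * Moving the sphere to the origin *)

Lemma gap_ge0_of_no_negmin l : 0 < l -> (forall x, closure Omega x -> ~ negmin l x) ->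
  forall x, Omega x -> l < enorm x -> 0 <= gap l x.
Proof.
move=> l0 nomin x Ox lx; rewrite leNgt; apply/negP => gx.
pose K := closure Omega `&` [set y : V | l <= enorm y].
have cK : compact K.
  apply: compact_closedI; first exact: compact_closure.
  apply: (@closed_comp _ _ (@enorm R n) [set t | l <= t]); last exact: closed_ge.
  by move=> y _; exact: continuous_enorm.
have Kx : K x by split; [exact: subset_closure|exact: ltW].
have cw : {within K, continuous (gap l)}.
  apply: continuous_in_subspaceT => y; rewrite inE => -[_ /= ly].
  by apply: continuous_gap => //; rewrite -enorm_gt0 (lt_le_trans l0).
have [x1 + xmin] := compact_EVT_min (ex_intro _ x Kx) cK cw.
rewrite inE => -[cl1 /= lx1].
have g1 : gap l x1 < 0 by apply: le_lt_trans gx; apply: xmin; rewrite inE.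
have Ox1 : Omega x1 by apply: contrapT => /(gap_out l); rewrite leNgt g1.
apply: (nomin x1 cl1); split => //.
  rewrite lt_neqAle lx1 andbT; apply/eqP => /esym /(gap_sphere l0) g1'.
  by move: g1; rewrite g1' ltxx.
move=> y Oy ly; apply: xmin; rewrite inE; split; first exact: subset_closure.
exact: ltW.
Qed.

Lemma no_negmin_near C l0 p : smooth_boundary Omega -> 0 < C -> touch_const C -> 0 < l0 ->
  (forall x, Omega x -> l0 < enorm x -> 0 < gap l0 x) -> closure Omega p ->
  \forall x \near p & l \near l0, ~ negmin l x.
Proof.
move=> smooth C0 tC l00 gpos clp.
have [pl|lp|pl] := ltgtP (enorm p) l0.
- pose m := (enorm p + l0) / 2.
  have pm : enorm p < m by rewrite /m; lra.
  have ml : m < l0 by rewrite /m; lra.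
  exists ([set x | enorm x < m], [set l | m < l]) => /=.
    split; last exact: lt_nbhsr.
    by apply: (@continuous_enorm _ _ p [set t | t < m]); exact: lt_nbhsl.
  by move=> [x l] /= [xm lm] [_ lx _ _]; move: (lt_trans lm lx); rewrite ltNge (ltW xm).
- have [Op|nOp] := pselect (Omega p); last first.
    apply: (no_negmin_boundary C0 tC l00 smooth _ lp).
    by split => // /interior_subset.
  have pN0 : p != 0 by rewrite -enorm_gt0 (lt_trans l00).
  have near_pos : \forall q \near (l0, p), 0 < gap q.1 q.2.
    have cg := cvg_gap l00 pN0; apply: (cg [set t | 0 < t]).
    by apply: lt_nbhsr; exact: gpos.
  have cswap : (fun q : V * R => (q.2, q.1)) @ (p, l0) --> (l0, p).
    have c1 : (fun q : V * R => q.2) @ (p, l0) --> l0 by exact: cvg_snd.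
    have c2 : (fun q : V * R => q.1) @ (p, l0) --> p by exact: cvg_fst.
    exact: (cvg_pair c1 c2).
  have np : \forall q \near (p, l0), 0 < gap q.2 q.1 by exact: (cswap _ near_pos).
  apply: filterS np => -[x l] /= g0 [_ _ + _].
  by rewrite ltNge (ltW g0).
- exact: (no_negmin_sphere C0 tC l00 pl).
Qed.

(** L is the infimum of the radii above which the gap is nonnegative; L > 0 would
    allow the sphere to move further, by compactness of the closure of Omega. *)
Lemma moving_spheres : smooth_boundary Omega -> forall l x, 0 < l -> Omega x ->
  l < enorm x -> 0 <= gap l x.
Proof.
move=> smooth; pose S := [set l | 0 < l /\
  forall l', l <= l' -> forall x, Omega x -> l' < enorm x -> 0 <= gap l' x].
have [C C0 tC] := gap_touch; have [r r0 Or] := enorm_bound.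
have Sr : S r.
  split => // l' rl x /Or xr lx.
  by move: (le_lt_trans rl lx); rewrite ltNge xr.
have infS : has_inf S by split; [exists r|exists 0 => l [/ltW]].
pose L : R := inf S.
have above l : L < l -> forall x, Omega x -> l < enorm x -> 0 <= gap l x.
  rewrite -subr_gt0 => /inf_adherent /(_ infS) [s [_ Ss]].
  by rewrite addrC subrK => /ltW; exact: Ss.
suff : L <= 0 by move=> S0 l x l0; apply: above; exact: le_lt_trans l0.
rewrite leNgt; apply/negP => L0.
have gL x : Omega x -> L < enorm x -> 0 <= gap L x.
  move=> Ox Lx; rewrite leNgt; apply/negP => gx.
  have xN0 : x != 0 by rewrite -enorm_gt0 (lt_trans L0).
  have cl : (fun l : R => gap l x) @ L --> gap L x.
    have c1 : (fun l : R => l) @ L --> L by exact: cvg_id.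
    have c2 : (fun _ : R => x) @ L --> x by exact: (cvg_cst x (F := nbhs L)).
    exact: (cvg_comp _ _ (cvg_pair c1 c2) (cvg_gap L0 xN0)).
  have nl : \forall l \near L, gap l x < 0.
    by apply: (cl [set t | t < 0]); exact: lt_nbhsl.
  have ex : \forall l \near L^'+, [/\ gap l x < 0, L < l & l < enorm x].
    near=> l; split; near: l; [|exact: nbhs_right_gt|exact: nbhs_right_lt].
    exact: (cvg_within _ nl).
  have PF : ProperFilter L^'+ by exact: at_right_proper_filter.
  have [l [gl Ll lx]] := @filter_ex _ _ PF _ ex.
  by move: gl; rewrite ltNge above.
have gLpos := gap_gt0 L0 gL.
have /compact_near_coveringP cov := compact_closure.
have near_nomin : \forall l \near L, forall x, closure Omega x -> ~ negmin l x.
  apply: (cov _ (nbhs L) (fun l x => ~ negmin l x)) => p clp.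
  exact: (no_negmin_near smooth C0 tC L0 gLpos).
have [e e0 he] : exists2 e : R, 0 < e & forall l, `|L - l| < e ->
    0 < l /\ forall x, closure Omega x -> ~ negmin l x.
  have : \forall l \near L, 0 < l /\ forall x, closure Omega x -> ~ negmin l x.
    by near=> l; split; near: l; [exact: lt_nbhsr|].
  by move=> /nbhs_ballP [e /= e0 he]; exists e.
have Le l : L - e < l -> l <= L -> `|L - l| < e.
  by move=> Lel lL; rewrite ger0_norm ?subr_ge0 // ltrBlDr -ltrBlDl.
have S2 : S (L - e / 2).
  have e2 : L - e < L - e / 2 by rewrite ltrD2l ltrN2 ltr_pdivrMr // ltr_pMr // ltr1n.
  have eL : L - e / 2 <= L by rewrite gerBl divr_ge0 // ltW.
  split=> [|l' ll']; first by case: (he _ (Le _ e2 eL)).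
  have [l'L|] := leP l' L; last exact: above.
  have [l'0 nomin] := he _ (Le _ (lt_le_trans e2 ll') l'L).
  exact: gap_ge0_of_no_negmin.
have := inf_lbound infS.2 S2; rewrite -/L lerBrDr gerDl.
by rewrite leNgt divr_gt0.
Unshelve. all: by end_near. Qed.

(** If B bounds U, take l = t |x| with t^k = U(x) / (2 B): then v_l(x) is at most
    t^k B = U(x) / 2, so that U <= v_l fails at x. *)
Lemma no_positive_solution : smooth_boundary Omega -> Omega 0 -> (0 < n)%N -> False.
Proof.
move=> smooth Om0 npos; pose v : V := delta_mx 0 (Ordinal npos).
have vN0 : v != 0.
  apply/eqP => /rowP /(_ (Ordinal npos)) /eqP; rewrite !mxE !eqxx /=.
  by rewrite oner_eq0.
have [x Ox xN0] : exists2 x, Omega x & x != 0.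
  have nO : \forall t \near (0 : R), Omega (t *: v).
    have c : (fun t : R => t *: v) @ 0 --> 0 *: v by exact: scalel_continuous.
    by apply: c; rewrite scale0r; exact: open_nbhs_nbhs.
  have ex : \forall t \near (0 : R)^'+, Omega (t *: v) /\ 0 < t.
    near=> t; split; near: t; last exact: nbhs_right_gt.
    exact: (cvg_within _ nO).
  have [t [Ot t0]] := filter_ex ex.
  by exists (t *: v) => //; rewrite scaler_eq0 negb_or vN0 gt_eqF.
have r0 : 0 < enorm x by rewrite enorm_gt0.
have [B B0 UB] := U_bound.
have ux := ext_gt0 Ox.
pose c := U x / (2 * B).
have c0 : 0 < c by rewrite divr_gt0 // mulr_gt0.
have c1 : c < 1.
  rewrite ltr_pdivrMr ?mulr_gt0 // mul1r (le_lt_trans (UB x)) //.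
  by rewrite ltr_pMl // ltr1n.
pose t := c `^ k^-1.
have t0 : 0 < t by exact: powR_gt0.
have tk : t `^ k = c by rewrite -powRrM mulVf ?gt_eqF // powRr1 // ltW.
have t1 : t < 1.
  rewrite ltNge; apply/negP => t1; move: c1; rewrite -tk ltNge => /negP; apply.
  apply: (@le_trans _ _ (1 `^ k)); first by rewrite powR1.
  by apply: ge0_ler_powR; rewrite ?nnegrE ?(ltW t0) // ltW.
have lx : t * enorm x < enorm x by rewrite gtr_pMl.
have := moving_spheres smooth (mulr_gt0 t0 r0) Ox lx.
rewrite /gap subr_ge0 /kelvin mulfK ?gt_eqF // tk => h.
have : U x <= c * B by rewrite (le_trans h) // ler_pM2l // UB.
have -> : c * B = U x / 2 by rewrite /c; field; rewrite gt_eqF.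
by rewrite leNgt ltr_pdivrMr // ltr_pMr // ltr1n.
Unshelve. all: by end_near. Qed.

End Solution.

Theorem theorem1 (R : realType) (N : nat) (hN : (3 <= N)%N)
  (a : R) (ha : 0 < N%:R - 2 + a)
  (Omega : set 'rV[R]_N)
  (Omega_open : open Omega) (Omega_conn : connected Omega)
  (Omega_bounded : bounded_set Omega) (Omega0 : Omega 0)
  (Omega_star : star_shaped0 Omega) (Omega_smooth : smooth_boundary Omega)
  (f : 'rV[R]_N -> R -> R) (hf : admissible a Omega f)
  (f_scaling : forall (x : 'rV[R]_N) (y : R), punctured Omega x -> 0 <= y ->
     forall mu nu : R, 1 <= mu -> mu <= nu ->
       mu `^ (- ((N%:R + 2 - a) / (N%:R - 2 + a)))
         * f (mu `^ (- (2 / (N%:R - 2 + a))) *: x) (mu * y)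
       <= nu `^ (- ((N%:R + 2 - a) / (N%:R - 2 + a)))
         * f (nu `^ (- (2 / (N%:R - 2 + a))) *: x) (nu * y)) :
  ~ exists u : 'rV[R]_N -> R, positive_solution a Omega f u.
Proof.
move=> [u u_sol].
apply: (no_positive_solution ha Omega_open Omega_bounded Omega_star hf f_scaling u_sol) => //.
exact: leq_trans hN.
Qed.
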